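(* Suppose given a commutative square of $\mathcal{O}$-Tambara functors $$\begin{array}{ccc}R'&\to&S'\\ \downarrow&&\downarrow\\ R&\to&S.\end{array}$$ Then there is an induced morphism $R\boxtimes_{R'}L_{S'|R'}\to L_{S|R}$ which is a map of (simplicial) $R\boxtimes_{R'}S'$-modules.
   Context: Let $G$ be a finite group. An indexing system $\mathcal{O}$ assigns to each subgroup $H\le G$ a class $\mathcal{O}(G/H)$ of finite $H$-sets, closed under isomorphism, restriction, conjugation and disjoint union, containing all trivial $H$-sets, closed under finite limits, and closed under self-induction: if $H/K\in\mathcal{O}(G/H)$ and $T\in\mathcal{O}(G/K)$ then $H\times_K T\in\mathcal{O}(G/H)$. A map $f:X\to Y$ of finite $G$-sets is admissible if $G_{f(x)}/G_x\in\mathcal{O}(G/G_{f(x)})$ for all $x\in X$. An $\mathcal{O}$-Tambara functor is a commutative Green functor $R$ for $G$ (a commutative monoid in Mackey functors under the box product $\boxtimes$; transfers $T_f$, restrictions $R_f$) together with multiplicative norm maps $N_f:R(X)\to R(Y)$ for each admissible $f:X\to Y$, functorial in $f$, equal to multiplication for fold maps, and satisfying the double coset formulas and Tambara reciprocity. Modules over $R$ are modules over the underlying Green functor; $\boxtimes_R$ is the relative box product. An $A$-algebra is an $\mathcal{O}$-Tambara functor under $A$; $\boxtimes_A$ is the coproduct of $A$-algebras. For an ideal $I$ (kernel of a map of $\mathcal{O}$-Tambara functors) of $S$, $I^{>1}$ is the smallest ideal of $S$ containing all $N_f(i)$ with $f:X\to Y$ admissible and 2-surjective (every fiber has at least 2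 elements) and $i\in I(X)$. The module of Kähler differentials of $A\to B$ is $\Omega_{A|B}=I/I^{>1}$ where $I=\ker(B\boxtimes_A B\to B)$. In simplicial $A$-algebras (weak equivalences: isomorphisms on $\pi_*$; fibrations: maps surjective on normalized chains in degrees $n\ge1$), let $cA\to P\to cB$ be a factorization of the map of constant simplicial objects into a cofibration followed by an acyclic fibration; $P$ may be taken levelwise free over $A$. The cotangent complex is the simplicial $B$-module $L_{B|A}=\Omega_{P|A}\boxtimes_P B$ (levelwise), well defined up to homotopy equivalence. $L_{S|R}$ is regarded as an $R\boxtimes_{R'}S'$-module via the canonical map $R\boxtimes_{R'}S'\to S$ given by the square. *)

(* Defs.v *)
(* Group actions are MathComp right actions (x . (gh) = (x . g) . h);
   left G-sets become right G-sets through inversion, H/K becomes the set of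
   right cosets K \ H, and H x_K T becomes T x_K H.  Rings are allowed to be
   zero (comPzRingType), since a Tambara functor is zero at the empty G-set.

   Objects that are determined by a universal property only up to unique
   isomorphism (pullbacks, disjoint unions, dependent products of G-sets,
   coproducts of A-algebras, relative box products, quotients) are described by
   predicates or records of which every concrete model is an instance. *)
From HB Require Import structures.
From mathcomp Require Import all_boot all_order all_algebra all_fingroup.

Set Implicit Arguments.
Unset Strict Implicit.
Unset Printing Implicit Defensive.

Import GRing.Theory.

Local Open Scope group_scope.

Section FiniteSets.

Variable gT : finGroupType.

Record hset (H : {group gT}) := HSet {
  hs_sort :> finType;
  hs_act : action H hs_sort
}.

Record hmap (H : {group gT}) (X Y : hset H) := HMap {
  hm_fun :> X -> Y;
  hm_equiv : forall x, {in H, forall h, hm_fun (hs_act X x h) = hs_act Y (hm_fun x) h}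
}.

Section Category.

Variable H : {group gT}.

Lemma hm_id_equiv (X : hset H) (x : X) :
  {in H, forall h, id (hs_act X x h) = hs_act X (id x) h}.
Proof. by []. Qed.

Definition hm_id (X : hset H) : hmap X X := HMap (@hm_id_equiv X).

Lemma hm_comp_equiv (X Y Z : hset H) (g : hmap Y Z) (f : hmap X Y) (x : X) :
  {in H, forall h, g (f (hs_act X x h)) = hs_act Z (g (f x)) h}.
Proof. by move=> h hH; rewrite !hm_equiv. Qed.

Definition hm_comp (X Y Z : hset H) (g : hmap Y Z) (f : hmap X Y) : hmap X Z :=
  HMap (hm_comp_equiv g f).

Definition is_pullback (W X Z Y : hset H)
    (p : hmap W X) (q : hmap W Z) (f : hmap X Y) (g : hmap Z Y) : Prop :=
  (forall w, f (p w) = g (q w)) /\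
  (forall x z, f x = g z -> exists! w, p w = x /\ q w = z).

Definition is_disjoint_union (X Y U : hset H) (i : hmap X U) (j : hmap Y U) : Prop :=
  bijective (fun z : X + Y => match z with inl x => i x | inr y => j y end).

Definition is_trivial (X : hset H) : Prop :=
  forall x : X, {in H, forall h, hs_act X x h = x}.

(* X <-g- A <-e- P -q-> E -h-> Y : the points of E over y are the sections of g
   over the fiber of y, P is the pullback of E along f, and e is evaluation. *)
Record is_exponential (X Y A E P : hset H) (f : hmap X Y) (g : hmap A X)
    (h : hmap E Y) (p : hmap P X) (q : hmap P E) (e : hmap P A) : Prop := {
  exp_pullback : is_pullback p q f h;
  exp_eval : forall w, g (e w) = p w;
  exp_sections : forall (y : Y) (s : {x : X | f x == y} -> A),
    (forall x, g (s x) = val x) ->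
    exists! c : E, h c = y /\
      forall (w : P) (x : {x : X | f x == y}), q w = c -> p w = val x -> e w = s x
}.

End Category.

Definition restrict_hset (H K : {group gT}) (sKH : K \subset H) (T : hset H) : hset K :=
  HSet (hs_act T \ sKH)%act.

(* U is (T x H) / ((t . k, h) ~ (t, k h)), through (t, h) |-> eta t . h. *)
Definition is_induced (H K : {group gT}) (T : hset K) (U : hset H) (eta : T -> U) : Prop :=
  (forall u, exists t, exists2 h, h \in H & u = hs_act U (eta t) h) /\
  (forall t t', {in H &, forall h h',
     hs_act U (eta t) h = hs_act U (eta t') h' <->
     exists2 k, k \in K & h' = k * h /\ t = hs_act T t' k}).

Lemma coset_act_dom (H K : {group gT}) :
  H \subset subact_dom (fun B : {set gT} => B \in rcosets K H) 'Rs.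
Proof.
apply/subsetP=> h hH; rewrite !inE /=.
apply/subsetP=> B; rewrite !inE => /rcosetsP[x xH ->].
by apply/rcosetsP; exists (x * h); rewrite ?groupM // rcosetE rcosetM.
Qed.

Definition coset_hset (H K : {group gT}) : hset H :=
  HSet (subaction {B : {set gT} | B \in rcosets K H} 'Rs \ coset_act_dom H K)%act.

(* Finite limits are generated by the terminal object, which is trivial, and pullbacks. *)
Record indexing_system := IndexingSystem {
  is_adm :> forall H : {group gT}, hset H -> Prop;
  is_iso : forall H (S T : hset H) (f : hmap S T), bijective f -> is_adm S -> is_adm T;
  is_restriction : forall (H K : {group gT}) (sKH : K \subset H) (T : hset H),
    is_adm T -> is_adm (restrict_hset sKH T);
  is_conjugation : forall (H : {group gT}) (g : gT) (T : hset H) (U : hset (H :^ g)%G)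
    (c : T -> U), bijective c ->
    (forall t, {in H, forall h, c (hs_act T t h) = hs_act U (c t) (h ^ g)}) ->
    is_adm T -> is_adm U;
  is_union : forall H (S T U : hset H) (i : hmap S U) (j : hmap T U),
    is_disjoint_union i j -> is_adm S -> is_adm T -> is_adm U;
  is_triv : forall H (T : hset H), is_trivial T -> is_adm T;
  is_limit : forall H (W S T U : hset H)
    (p : hmap W S) (q : hmap W T) (f : hmap S U) (g : hmap T U),
    is_pullback p q f g -> is_adm S -> is_adm T -> is_adm U -> is_adm W;
  is_self_induction : forall (H K : {group gT}) (T : hset K) (U : hset H) (eta : T -> U),
    K \subset H -> is_induced eta -> is_adm (coset_hset H K) -> is_adm T -> is_adm U
}.

Definition gset := hset [set: gT]%G.

Definition stab (X : gset) (x : X) : {group gT} := 'C[x | hs_act X]%G.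

Definition admissible (O : indexing_system) (X Y : gset) (f : hmap X Y) : Prop :=
  forall x : X, O (stab (f x)) (coset_hset (stab (f x)) (stab x)).

Definition two_surjective (X Y : gset) (f : hmap X Y) : Prop :=
  forall y : Y, (1 < #|[set x | f x == y]|)%N.

End FiniteSets.

Local Open Scope ring_scope.

Section Functors.

Variable gT : finGroupType.
Local Notation gset := (gset gT).

Record mackey_laws (M : gset -> zmodType)
    (res : forall X Y : gset, hmap X Y -> M Y -> M X)
    (tr : forall X Y : gset, hmap X Y -> M X -> M Y) : Prop := {
  res_id : forall X (m : M X), res _ _ (hm_id X) m = m;
  res_comp : forall X Y Z (g : hmap Y Z) (f : hmap X Y) (m : M Z),
    res _ _ (hm_comp g f) m = res _ _ f (res _ _ g m);
  tr_id : forall X (m : M X), tr _ _ (hm_id X) m = m;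
  tr_comp : forall X Y Z (g : hmap Y Z) (f : hmap X Y) (m : M X),
    tr _ _ (hm_comp g f) m = tr _ _ g (tr _ _ f m);
  double_coset : forall W X Z Y
    (p : hmap W X) (q : hmap W Z) (f : hmap X Y) (g : hmap Z Y), is_pullback p q f g ->
    forall m : M X, res _ _ g (tr _ _ f m) = tr _ _ q (res _ _ p m);
  empty_zero : forall X (m : M X), #|X| = 0%N -> m = 0;
  union_prod : forall X Y U (i : hmap X U) (j : hmap Y U), is_disjoint_union i j ->
    forall (a : M X) (b : M Y), exists! u : M U, res _ _ i u = a /\ res _ _ j u = b
}.

(* Commutative monoids for the box product, unwound: levelwise commutative
   rings, multiplicative restrictions, Frobenius reciprocity. *)
Record green := Green {
  gr_ob :> gset -> comPzRingType;
  gr_res : forall X Y : gset, hmap X Y -> {rmorphism gr_ob Y -> gr_ob X};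
  gr_tr : forall X Y : gset, hmap X Y -> {additive gr_ob X -> gr_ob Y};
  gr_laws : mackey_laws (fun X Y f => gr_res f) (fun X Y f => gr_tr f);
  gr_frobenius : forall X Y (f : hmap X Y) (b : gr_ob Y) (a : gr_ob X),
    gr_tr f (gr_res f b * a) = b * gr_tr f a
}.

Record gmap (R S : green) := GMap {
  gm_fun :> forall X, {rmorphism R X -> S X};
  gm_res : forall X Y (f : hmap X Y) (r : R Y), gm_fun X (gr_res R f r) = gr_res S f (gm_fun Y r);
  gm_tr : forall X Y (f : hmap X Y) (r : R X), gm_fun Y (gr_tr R f r) = gr_tr S f (gm_fun X r)
}.

Record module (R : green) := Module {
  md_ob :> forall X : gset, lmodType (R X);
  md_res : forall X Y : gset, hmap X Y -> {additive md_ob Y -> md_ob X};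
  md_tr : forall X Y : gset, hmap X Y -> {additive md_ob X -> md_ob Y};
  md_laws : mackey_laws (M := md_ob) (fun X Y f => md_res f) (fun X Y f => md_tr f);
  md_resZ : forall X Y (f : hmap X Y) (r : R Y) (m : md_ob Y),
    md_res f (r *: m) = gr_res R f r *: md_res f m;
  md_frobenius_l : forall X Y (f : hmap X Y) (r : R Y) (m : md_ob X),
    md_tr f (gr_res R f r *: m) = r *: md_tr f m;
  md_frobenius_r : forall X Y (f : hmap X Y) (r : R X) (m : md_ob Y),
    md_tr f (r *: md_res f m) = gr_tr R f r *: m
}.

Record mmap (R : green) (M N : module R) := MMap {
  mm_fun :> forall X, {linear M X -> N X};
  mm_res : forall X Y (f : hmap X Y) (m : M Y), mm_fun X (md_res M f m) = md_res N f (mm_fun Y m);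
  mm_tr : forall X Y (f : hmap X Y) (m : M X), mm_fun Y (md_tr M f m) = md_tr N f (mm_fun X m)
}.

End Functors.

Section RestrictionOfScalars.

Definition restr_sort (A B : comPzRingType) (f : {rmorphism A -> B}) (V : lmodType B) : Type := V.

Variables (A B : comPzRingType) (f : {rmorphism A -> B}) (V : lmodType B).

HB.instance Definition _ := GRing.Zmodule.copy (restr_sort f V) V.

Definition restr_scale (a : A) (v : restr_sort f V) : restr_sort f V := f a *: (v : V).

Fact restr_scaleA a b v : restr_scale a (restr_scale b v) = restr_scale (a * b) v.
Proof. by rewrite /restr_scale scalerA rmorphM. Qed.
Fact restr_scale1 : left_id 1 restr_scale.
Proof. by move=> v; rewrite /restr_scale rmorph1 scale1r. Qed.
Fact restr_scaleDr : right_distributive restr_scale +%R.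
Proof. by move=> a u v; rewrite /restr_scale scalerDr. Qed.
Fact restr_scaleDl v : {morph restr_scale^~ v : a b / a + b}.
Proof. by move=> a b; rewrite /restr_scale rmorphD scalerDl. Qed.

HB.instance Definition _ := GRing.Zmodule_isLmodule.Build A (restr_sort f V)
  restr_scaleA restr_scale1 restr_scaleDr restr_scaleDl.

End RestrictionOfScalars.

Section Modules.

Variable gT : finGroupType.
Local Notation gset := (gset gT).
Local Notation green := (green gT).

Section SelfModule.
Variable R : green.

Definition self_res X Y (f : hmap X Y) : {additive (R Y)^o -> (R X)^o} := gr_res R f.
Definition self_tr X Y (f : hmap X Y) : {additive (R X)^o -> (R Y)^o} := gr_tr R f.

Fact self_frobenius_r X Y (f : hmap X Y) (r : R X) (m : (R Y)^o) :
  self_tr f (r *: self_res f m) = gr_tr R f r *: m.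
Proof. by rewrite /GRing.scale /= mulrC gr_frobenius mulrC. Qed.

Definition self : module R :=
  @Module gT R (fun X => (R X)^o) self_res self_tr (gr_laws R)
    (fun X Y f => rmorphM (gr_res R f)) (@gr_frobenius _ R) self_frobenius_r.

End SelfModule.

Section Restrict.
Variables (A B : green) (phi : gmap A B) (M : module B).

Definition restr_ob (X : gset) : lmodType (A X) := restr_sort (phi X) (M X).
Definition restr_res X Y (f : hmap X Y) : {additive restr_ob Y -> restr_ob X} := md_res M f.
Definition restr_tr X Y (f : hmap X Y) : {additive restr_ob X -> restr_ob Y} := md_tr M f.

Fact restr_resZ X Y (f : hmap X Y) (r : A Y) (m : restr_ob Y) :
  restr_res f (r *: m) = gr_res A f r *: restr_res f m.
Proof. by rewrite /GRing.scale /= /restr_scale gm_res -md_resZ. Qed.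

Fact restr_frobenius_l X Y (f : hmap X Y) (r : A Y) (m : restr_ob X) :
  restr_tr f (gr_res A f r *: m) = r *: restr_tr f m.
Proof. by rewrite /GRing.scale /= /restr_scale gm_res -md_frobenius_l. Qed.

Fact restr_frobenius_r X Y (f : hmap X Y) (r : A X) (m : restr_ob Y) :
  restr_tr f (r *: restr_res f m) = gr_tr A f r *: m.
Proof. by rewrite /GRing.scale /= /restr_scale gm_tr -md_frobenius_r. Qed.

Definition restrict : module A :=
  @Module gT A restr_ob restr_res restr_tr (md_laws M)
    restr_resZ restr_frobenius_l restr_frobenius_r.

End Restrict.

(* A-bilinear Dress pairings M, N -> T, i.e. the families of maps that
   morphisms out of the box product of M and N relative to A represent. *)
Record pairing (A : green) (M N T : module A) := Pairing {
  pr_fun :> forall X, M X -> N X -> T X;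
  pr_Dl : forall X (m m' : M X) (n : N X), pr_fun (m + m') n = pr_fun m n + pr_fun m' n;
  pr_Dr : forall X (m : M X) (n n' : N X), pr_fun m (n + n') = pr_fun m n + pr_fun m n';
  pr_Zl : forall X (a : A X) (m : M X) (n : N X), pr_fun (a *: m) n = a *: pr_fun m n;
  pr_Zr : forall X (a : A X) (m : M X) (n : N X), pr_fun m (a *: n) = a *: pr_fun m n;
  pr_res : forall X Y (f : hmap X Y) (m : M Y) (n : N Y),
    pr_fun (md_res M f m) (md_res N f n) = md_res T f (pr_fun m n);
  pr_frobenius_l : forall X Y (f : hmap X Y) (m : M X) (n : N Y),
    pr_fun (md_tr M f m) n = md_tr T f (pr_fun m (md_res N f n));
  pr_frobenius_r : forall X Y (f : hmap X Y) (m : M Y) (n : N X),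
    pr_fun m (md_tr N f n) = md_tr T f (pr_fun (md_res M f m) n)
}.

(* T, with its pairing, is the relative box product of M and N over A. *)
Definition is_box (A : green) (M N T : module A) (beta : pairing M N T) : Prop :=
  forall (U : module A) (gamma : pairing M N U), exists2 h : mmap T U,
    (forall X (m : M X) (n : N X), h X (beta X m n) = gamma X m n) &
    (forall h' : mmap T U, (forall X (m : M X) (n : N X), h' X (beta X m n) = gamma X m n) ->
       forall X (t : T X), h' X t = h X t).

End Modules.

Section Tambara.

Variables (gT : finGroupType) (O : indexing_system gT).

Record tambara := Tambara {
  tb_green :> green gT;
  nm : forall X Y (f : hmap X Y), admissible O f -> tb_green X -> tb_green Y;
  nm_1 : forall X Y (f : hmap X Y) (af : admissible O f), nm af 1 = 1;
  nm_M : forall X Y (f : hmap X Y) (af : admissible O f), {morph nm af : a b / a * b};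
  nm_id : forall X (ai : admissible O (hm_id X)) a, nm ai a = a;
  nm_comp : forall X Y Z (g : hmap Y Z) (f : hmap X Y) (ag : admissible O g)
    (af : admissible O f) (agf : admissible O (hm_comp g f)) a, nm agf a = nm ag (nm af a);
  nm_fold : forall X U (i j : hmap X U) (f : hmap U X) (af : admissible O f),
    is_disjoint_union i j -> (forall x, f (i x) = x) -> (forall x, f (j x) = x) ->
    forall a, nm af a = gr_res tb_green i a * gr_res tb_green j a;
  nm_double_coset : forall W X Z Y
    (p : hmap W X) (q : hmap W Z) (f : hmap X Y) (g : hmap Z Y)
    (af : admissible O f) (aq : admissible O q), is_pullback p q f g ->
    forall a, gr_res tb_green g (nm af a) = nm aq (gr_res tb_green p a);
  nm_reciprocity : forall X Y A E P (f : hmap X Y) (g : hmap A X)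
    (h : hmap E Y) (p : hmap P X) (q : hmap P E) (e : hmap P A)
    (af : admissible O f) (aq : admissible O q), is_exponential f g h p q e ->
    forall a, nm af (gr_tr tb_green g a) = gr_tr tb_green h (nm aq (gr_res tb_green e a))
}.

Record tmap (R S : tambara) := TMap {
  tm_gmap :> gmap R S;
  tm_nm : forall X Y (f : hmap X Y) (af : admissible O f) (r : R X),
    tm_gmap Y (nm af r) = nm af (tm_gmap X r)
}.

Definition tm_eq (R S : tambara) (u v : tmap R S) : Prop := forall X (r : R X), u X r = v X r.

Definition gm_id (R : green gT) : gmap R R :=
  @GMap gT R R (fun X => idfun) (fun X Y f r => erefl) (fun X Y f r => erefl).

Definition tm_id (R : tambara) : tmap R R :=
  @TMap R R (gm_id R) (fun X Y f af r => erefl).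

Section Composition.
Variables (R S T : tambara) (v : tmap S T) (u : tmap R S).

Definition comp_fun (X : gset gT) : {rmorphism R X -> T X} := v X \o u X.
Fact comp_res X Y (f : hmap X Y) (r : R Y) :
  comp_fun X (gr_res R f r) = gr_res T f (comp_fun Y r).
Proof. by rewrite /= !gm_res. Qed.
Fact comp_tr X Y (f : hmap X Y) (r : R X) :
  comp_fun Y (gr_tr R f r) = gr_tr T f (comp_fun X r).
Proof. by rewrite /= !gm_tr. Qed.
Definition gm_comp : gmap R T := GMap comp_res comp_tr.
Fact comp_nm X Y (f : hmap X Y) (af : admissible O f) (r : R X) :
  gm_comp Y (nm af r) = nm af (gm_comp X r).
Proof. by rewrite /= !tm_nm. Qed.
Definition tm_comp : tmap R T := TMap comp_nm.

End Composition.

Definition is_coproduct (A B1 B2 C : tambara) (f : tmap A B1) (g : tmap A B2)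
    (i : tmap B1 C) (j : tmap B2 C) : Prop :=
  tm_eq (tm_comp i f) (tm_comp j g) /\
  forall (D : tambara) (u : tmap B1 D) (v : tmap B2 D), tm_eq (tm_comp u f) (tm_comp v g) ->
    exists2 w : tmap C D, tm_eq (tm_comp w i) u /\ tm_eq (tm_comp w j) v &
    forall w' : tmap C D, tm_eq (tm_comp w' i) u -> tm_eq (tm_comp w' j) v -> tm_eq w' w.

Definition is_ideal (S : tambara) (J : forall X, S X -> Prop) : Prop :=
  exists (T : tambara) (u : tmap S T), forall X (s : S X), J X s <-> u X s = 0.

(* The smallest ideal, as the intersection of all ideals, that contains the norms of
   elements of I along 2-surjective admissible maps. *)
Definition power_gt1 (S : tambara) (I : forall X, S X -> Prop) X (s : S X) : Prop :=
  forall J : forall X, S X -> Prop, is_ideal J ->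
    (forall Y Z (f : hmap Y Z) (af : admissible O f), two_surjective f ->
       forall i : S Y, I Y i -> J Z (nm af i)) ->
    J X s.

Definition kernel (S T : tambara) (u : tmap S T) (X : gset gT) : Type := {s : S X | u X s == 0}.

(* q presents the B-module Omega as I / I^{>1}, for I = kernel mu and mu : C -> B onto:
   the C-module I / I^{>1} is a B-module through mu. *)
Record is_conormal (C B : tambara) (mu : tmap C B) (Omega : module B)
    (q : forall X, kernel mu X -> Omega X) : Prop := {
  cn_D : forall X (x y z : kernel mu X), val z = val x + val y -> q _ z = q _ x + q _ y;
  cn_Z : forall X (c : C X) (x z : kernel mu X), val z = c * val x -> q _ z = mu X c *: q _ x;
  cn_res : forall X Y (f : hmap X Y) (y : kernel mu Y) (x : kernel mu X),
    val x = gr_res C f (val y) -> q _ x = md_res Omega f (q _ y);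
  cn_tr : forall X Y (f : hmap X Y) (x : kernel mu X) (y : kernel mu Y),
    val y = gr_tr C f (val x) -> q _ y = md_tr Omega f (q _ x);
  cn_surj : forall X (w : Omega X), exists x : kernel mu X, q _ x = w;
  cn_ker : forall X (x : kernel mu X),
    q _ x = 0 <-> power_gt1 (fun Y (c : C Y) => mu Y c = 0) (val x)
}.

End Tambara.

Section Simplicial.

Local Notation "[ n ]" := 'I_n.+1 (only parsing).

Section Face.
Variables (n : nat) (i : 'I_n.+2).
Fact face_homo : {homo lift i : x y / (x <= y)%O}.
Proof. by move=> x y; rewrite !leEord /= leq_bump2. Qed.
HB.instance Definition _ := Order.isOrderMorphism.Build _ [n] _ [n.+1] (lift i) face_homo.
Definition face : {omorphism [n] -> [n.+1]} := lift i.
End Face.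

Definition simp_comp (k m n : nat) (v : {omorphism [m] -> [n]}) (u : {omorphism [k] -> [m]}) :
  {omorphism [k] -> [n]} := v \o u.

Variables (gT : finGroupType) (O : indexing_system gT).
Local Notation tambara := (tambara O).

Record stambara := STambara {
  st_ob :> nat -> tambara;
  st_map : forall m n, {omorphism [m] -> [n]} -> tmap (st_ob n) (st_ob m);
  st_id : forall n, tm_eq (st_map (idfun : {omorphism [n] -> [n]})) (tm_id (st_ob n));
  st_comp : forall k m n (v : {omorphism [m] -> [n]}) (u : {omorphism [k] -> [m]}),
    tm_eq (st_map (simp_comp v u)) (tm_comp (st_map u) (st_map v))
}.

Record stmap (P Q : stambara) := STMap {
  stm_fun :> forall n, tmap (P n) (Q n);
  stm_nat : forall m n (u : {omorphism [m] -> [n]}),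
    tm_eq (tm_comp (stm_fun m) (st_map P u)) (tm_comp (st_map Q u) (stm_fun n))
}.

Definition stm_eq (P Q : stambara) (u v : stmap P Q) : Prop := forall n, tm_eq (u n) (v n).

Section Composition.
Variables (P Q T : stambara) (v : stmap Q T) (u : stmap P Q).
Fact stm_comp_nat m n (w : {omorphism [m] -> [n]}) :
  tm_eq (tm_comp (tm_comp (v m) (u m)) (st_map P w)) (tm_comp (st_map T w) (tm_comp (v n) (u n))).
Proof.
move=> X x /=.
have /= -> := stm_nat u w x.
exact: (stm_nat v w (u n X x)).
Qed.
Definition stm_comp : stmap P T := @STMap P T (fun n => tm_comp (v n) (u n)) stm_comp_nat.
End Composition.

Definition stm_id (P : stambara) : stmap P P :=
  @STMap P P (fun n => tm_id (P n)) (fun m n u X x => erefl).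

Definition const (A : tambara) : stambara :=
  @STambara (fun _ => A) (fun _ _ _ => tm_id A)
    (fun _ X x => erefl) (fun _ _ _ _ _ X x => erefl).

Definition const_map (A B : tambara) (f : tmap A B) : stmap (const A) (const B) :=
  @STMap (const A) (const B) (fun _ => f) (fun _ _ _ X x => erefl).

Definition dface (P : stambara) (n : nat) (i : 'I_n.+2) X (x : P n.+1 X) : P n X :=
  st_map P (face i) X x.

(* Normalized chains: all faces but the zeroth vanish; the differential is the zeroth face. *)
Definition normalized (P : stambara) X (n : nat) : P n X -> Prop :=
  match n with
  | 0 => fun _ => True
  | n'.+1 => fun x => forall i : 'I_n'.+2, i != ord0 -> dface i x = 0
  end.

Definition cycle (P : stambara) X (n : nat) : P n X -> Prop :=
  match n with
  | 0 => fun _ => True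
  | n'.+1 => fun x => normalized x /\ dface ord0 x = 0
  end.

Definition boundary (P : stambara) X (n : nat) (x : P n X) : Prop :=
  exists2 y : P n.+1 X, normalized y & dface ord0 y = x.

(* Bijectivity on pi_n = cycles / boundaries. *)
Definition weak_equivalence (P Q : stambara) (p : stmap P Q) : Prop :=
  forall X n,
    (forall x : P n X, cycle x -> boundary (p n X x) -> boundary x) /\
    (forall y : Q n X, cycle y -> exists2 x : P n X, cycle x & boundary (y - p n X x)).

Definition fibration (P Q : stambara) (p : stmap P Q) : Prop :=
  forall X n (y : Q n.+1 X), normalized y -> exists2 x : P n.+1 X, normalized x & p n.+1 X x = y.

Definition acyclic_fibration (P Q : stambara) (p : stmap P Q) : Prop :=
  weak_equivalence p /\ fibration p.

(* A commutative square whose top left corner is a simplicial A-algebra is a square of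
   simplicial A-algebras, so the left lifting property does not depend on A. *)
Definition cofibration (Q P : stambara) (i : stmap Q P) : Prop :=
  forall (E B : stambara) (p : stmap E B), acyclic_fibration p ->
  forall (u : stmap Q E) (v : stmap P B), stm_eq (stm_comp p u) (stm_comp v i) ->
  exists2 h : stmap P E, stm_eq (stm_comp h i) u & stm_eq (stm_comp p h) v.

Record smodule (P : stambara) := SModule {
  sm_ob :> forall n, module (P n);
  sm_map : forall m n (u : {omorphism [m] -> [n]}),
    mmap (sm_ob n) (restrict (st_map P u) (sm_ob m));
  sm_id : forall n X (x : sm_ob n X), sm_map (idfun : {omorphism [n] -> [n]}) X x = x;
  sm_comp : forall k m n (v : {omorphism [m] -> [n]}) (u : {omorphism [k] -> [m]}) X
    (x : sm_ob n X), sm_map (simp_comp v u) X x = sm_map u X (sm_map v X x)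
}.

(* Maps of simplicial P-modules from M to N regarded as a P-module along phi. *)
Record smmap (P Q : stambara) (phi : stmap P Q) (M : smodule P) (N : smodule Q) := SMMap {
  smm_fun :> forall n, mmap (M n) (restrict (phi n) (N n));
  smm_nat : forall m n (u : {omorphism [m] -> [n]}) X (x : M n X),
    smm_fun m X (sm_map M u X x) = sm_map N u X (smm_fun n X x)
}.

(* Levelwise Kaehler differentials of the simplicial A-algebra P. *)
Record kaehler (A : tambara) (P : stambara) (i : stmap (const A) P) := Kaehler {
  ka_square : stambara;
  ka_l : stmap P ka_square;
  ka_r : stmap P ka_square;
  ka_coproduct : forall n, is_coproduct (i n) (i n) (ka_l n) (ka_r n);
  ka_mu : stmap ka_square P;
  ka_mul : stm_eq (stm_comp ka_mu ka_l) (stm_id P);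
  ka_mur : stm_eq (stm_comp ka_mu ka_r) (stm_id P);
  ka_omega : smodule P;
  ka_q : forall n X, kernel (ka_mu n) X -> ka_omega n X;
  ka_conormal : forall n, is_conormal (@ka_q n);
  ka_nat : forall m n (u : {omorphism [m] -> [n]}) X
    (x : kernel (ka_mu n) X) (y : kernel (ka_mu m) X),
    val y = st_map ka_square u X (val x) -> ka_q y = sm_map ka_omega u X (ka_q x)
}.

(* A model of L_{B|A} : a factorization const A -> P -> const B and the B-module
   cc_L = Omega_{P|A} box_P B, with universal pairing cc_pair (w, b) = w (x) b. *)
Record cotangent_complex (A B : tambara) (f : tmap A B) := CotangentComplex {
  cc_P : stambara;
  cc_i : stmap (const A) cc_P;
  cc_p : stmap cc_P (const B);
  cc_factor : stm_eq (stm_comp cc_p cc_i) (const_map f);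
  cc_cofibration : cofibration cc_i;
  cc_acyclic_fibration : acyclic_fibration cc_p;
  cc_kaehler : kaehler cc_i;
  cc_L :> smodule (const B);
  cc_pair : forall n,
    pairing (ka_omega cc_kaehler n) (restrict (cc_p n) (self B)) (restrict (cc_p n) (cc_L n));
  cc_box : forall n, is_box (cc_pair n);
  cc_linear : forall n X (w : ka_omega cc_kaehler n X) (b b' : B X),
    cc_pair n X w (b * b') = b *: (cc_pair n X w b' : cc_L n X);
  cc_nat : forall m n (u : {omorphism [m] -> [n]}) X (w : ka_omega cc_kaehler n X) (b : B X),
    cc_pair m X (sm_map (ka_omega cc_kaehler) u X w) b = sm_map cc_L u X (cc_pair n X w b)
}.

(* A model of R box_{R'} M for a simplicial S'-module M, with its structure of module over
   C = R box_{R'} S', in which (i r * j s) (r1 (x) m) = (r r1) (x) (s m). *)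
Record base_change (R' R S' C : tambara) (a : tmap R' R) (f' : tmap R' S')
    (i : tmap R C) (j : tmap S' C) (M : smodule (const S')) := BaseChange {
  bc_mod :> smodule (const C);
  bc_pair : forall n, pairing (restrict a (self R)) (restrict f' (M n))
    (restrict (tm_comp i a) (bc_mod n));
  bc_box : forall n, is_box (bc_pair n);
  bc_linear : forall n X (r r1 : R X) (s : S' X) (m : M n X),
    bc_pair n X (r * r1) (s *: m) = (i X r * j X s) *: (bc_pair n X r1 m : bc_mod n X);
  bc_nat : forall m n (u : {omorphism [m] -> [n]}) X (r : R X) (x : M n X),
    bc_pair m X r (sm_map M u X x) = sm_map bc_mod u X (bc_pair n X r x)
}.

End Simplicial.

(* Main.v *)
From HB Require Import structures.
Require Import Defs.
From mathcomp Require Import all_boot all_order all_algebra all_fingroup.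
From mathcomp Require Import boolp.

Set Implicit Arguments.
Unset Strict Implicit.
Unset Printing Implicit Defensive.

Import GRing.Theory.

Local Open Scope ring_scope.

(** The lift phi : P' -> P exists because R' -> P' is a cofibration and P -> S
    an acyclic fibration.  From phi on, everything is forced on generators.
    The coproduct property of P' box_{R'} P' gives psi; it carries the ideal I'
    to I, and I'^{>1} to I^{>1} since the preimage of an ideal is an ideal
    ([power_gt1_map]); so it induces Omega_{P'|R'} -> Omega_{P|R}
    ([kaehler_map]).  Tensoring with b : S' -> S gives lambda : L' -> L
    ([cotangent_map]), and r (x) m |-> f r * lambda m gives
    Lambda : R box_{R'} L' -> L ([base_change_map]).

    The difficulty is that a relative box product over A only represents
    A-bilinear pairings, so the induced maps come out A-linear, whereas lambda
    must be S'-linear and Lambda must be C-linear for C = R box_{R'} S'.  At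
    a fixed G-set X the pure tensors do not span a box product: its elements
    are sums of transfers of pure tensors living on other G-sets.  Both this fact and its
    use are packaged as an induction principle ([box_ind]): a submodule that
    contains the pure tensors is everything, because the universal property
    retracts the whole module onto it.  By this principle, B-linearity of a map
    can be tested on pure tensors ([box_linear_map]).

    For S' that test is immediate.  For C one must know the elements of C, which
    is given only as a coproduct of Tambara functors: each of them is a single
    transfer T_h (i r * j s) ([coproduct_transfer_of_product]).  The elements of this form
    make up a sub-Tambara functor that contains the images of i and j, and so it
    is all of C, again by the universal property ([coproduct_ind]).  Sums are
    handled by disjoint unions of G-sets, products by pullbacks and Frobenius
    reciprocity, norms by exponential diagrams and Tambara reciprocity.  The last
    point needs the existence of exponential diagrams ([exponential_exists]) and
    the stability of admissible maps under pullback ([admissible_pullback]). *)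

(** * Finite G-sets and admissible maps *)

Section GSets.

Variable gT : finGroupType.
Local Notation gset := (gset gT).
Implicit Types X Y Z : gset.

(** The domain of the action on a G-set is the whole group, so that the laws of an
    action need no membership conditions. *)
Lemma gact1 X (x : X) : hs_act X x 1%g = x.
Proof. exact: (@act1 gT setT X (hs_act X) x). Qed.

Lemma gactM X (x : X) g h : hs_act X x (g * h)%g = hs_act X (hs_act X x g) h.
Proof. exact: (@actMin gT setT X (hs_act X) x g h (in_setT g) (in_setT h)). Qed.

Lemma gequiv X Y (f : hmap X Y) x g : f (hs_act X x g) = hs_act Y (f x) g.
Proof. exact: hm_equiv (in_setT g). Qed.

Lemma gact_inj X g : injective (fun x : X => hs_act X x g).
Proof. exact: (@act_inj gT setT X (hs_act X) g). Qed.

Section BuildGSet.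
Variables (T : finType) (to : T -> gT -> T).
Hypotheses (to1 : forall x, to x 1%g = x)
  (toM : forall x g h, to x (g * h)%g = to (to x g) h).
Definition build_gset : gset := @HSet gT [set: gT]%G T (TotalAction to1 toM).
End BuildGSet.

Section BuildMap.
Variables (X Y : gset) (f : X -> Y).
Hypothesis fE : forall x g, f (hs_act X x g) = hs_act Y (f x) g.
Definition build_map : hmap X Y := @HMap gT _ X Y f (fun x g _ => fE x g).
End BuildMap.

Section SubGSet.
Variables (X : gset) (Q : pred X).
Hypothesis QE : forall x g, Q x -> Q (hs_act X x g).
Definition sub_act (u : {x | Q x}) (g : gT) : {x | Q x} :=
  exist _ (hs_act X (val u) g) (QE g (valP u)).
Fact sub_act1 u : sub_act u 1%g = u.
Proof. by apply: val_inj; rewrite /= gact1. Qed.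
Fact sub_actM u g h : sub_act u (g * h)%g = sub_act (sub_act u g) h.
Proof. by apply: val_inj; rewrite /= gactM. Qed.
Definition sub_gset : gset := build_gset sub_act1 sub_actM.
Definition sub_incl : hmap sub_gset X :=
  @build_map sub_gset X (fun u => val u) (fun x g => erefl).
End SubGSet.

Section ProdGSet.
Variables X Y : gset.
Definition prod_act (u : X * Y) (g : gT) : X * Y := (hs_act X u.1 g, hs_act Y u.2 g).
Fact prod_act1 u : prod_act u 1%g = u.
Proof. by case: u => x y; rewrite /prod_act /= !gact1. Qed.
Fact prod_actM u g h : prod_act u (g * h)%g = prod_act (prod_act u g) h.
Proof. by rewrite /prod_act /= !gactM. Qed.
Definition prod_gset : gset := build_gset prod_act1 prod_actM.
Definition prod_fst : hmap prod_gset X :=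
  @build_map prod_gset X (fun u => u.1) (fun x g => erefl).
Definition prod_snd : hmap prod_gset Y :=
  @build_map prod_gset Y (fun u => u.2) (fun x g => erefl).
End ProdGSet.

Definition pset_gset (X : gset) : gset := HSet ((hs_act X)^*)%act.

Lemma pullback_exists X Z Y (f : hmap X Y) (g : hmap Z Y) :
  exists (W : gset) (p : hmap W X) (q : hmap W Z), is_pullback p q f g.
Proof.
pose Q (u : prod_gset X Z) := f u.1 == g u.2.
have QE u h : Q u -> Q (hs_act (prod_gset X Z) u h).
  by rewrite /Q /= !gequiv => /eqP->.
exists (sub_gset QE), (hm_comp (prod_fst X Z) (sub_incl QE)),
  (hm_comp (prod_snd X Z) (sub_incl QE)); split=> [[u Qu]|x z fg] /=.
  exact/eqP.
have Qxz : Q (x, z) by apply/eqP.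
exists (exist _ (x, z) Qxz); split=> // -[[x' z'] Q'] /= [xx zz].
by apply: val_inj; rewrite /= xx zz.
Qed.

Section SumGSet.
Variables X Y : gset.
Definition sum_act (u : X + Y) (g : gT) : X + Y :=
  match u with inl x => inl (hs_act X x g) | inr y => inr (hs_act Y y g) end.
Fact sum_act1 u : sum_act u 1%g = u.
Proof. by case: u => x; rewrite /sum_act gact1. Qed.
Fact sum_actM u g h : sum_act u (g * h)%g = sum_act (sum_act u g) h.
Proof. by case: u => x; rewrite /sum_act gactM. Qed.
Definition sum_gset : gset := build_gset sum_act1 sum_actM.
Definition sum_inl : hmap X sum_gset := @build_map X sum_gset inl (fun x g => erefl).
Definition sum_inr : hmap Y sum_gset := @build_map Y sum_gset inr (fun x g => erefl).
Lemma sum_disjoint : is_disjoint_union sum_inl sum_inr.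
Proof. by exists id; case. Qed.
Section Copair.
Variables (Z : gset) (f : hmap X Z) (g : hmap Y Z).
Definition copair_fun (u : sum_gset) : Z := match u with inl x => f x | inr y => g y end.
Fact copairE u h : copair_fun (hs_act sum_gset u h) = hs_act Z (copair_fun u) h.
Proof. by case: u => x /=; rewrite gequiv. Qed.
Definition copair : hmap sum_gset Z := build_map copairE.
End Copair.
End SumGSet.

(** A section of g over the fiber of y is encoded by its image: a set B of points of
    A that g maps bijectively onto this fiber.  The group then acts on E through
    its action on subsets of A, the pullback P consists of the pairs (a, (y, B))
    with a in B, and evaluation is the first projection. *)
Lemma exponential_exists X Y A (f : hmap X Y) (g : hmap A X) :
  exists (E P : gset) (h : hmap E Y) (p : hmap P X) (q : hmap P E) (e : hmap P A),
    is_exponential f g h p q e.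
Proof.
pose QE (c : prod_gset Y (pset_gset A)) :=
  (g @: c.2 == [set x | f x == c.1]) &&
  [forall a in c.2, forall a' in c.2, (g a == g a') ==> (a == a')].
have QEP c k : QE c -> QE (hs_act (prod_gset Y (pset_gset A)) c k).
  case: c => y B /andP[/eqP gB /forall_inP injB]; apply/andP; split.
    rewrite /= /setact -imset_comp; apply/eqP/setP=> x; rewrite inE.
    apply/imsetP/eqP=> [[a aB ->] /=|fx].
      have : g a \in [set x | f x == y] by rewrite -gB; apply: imset_f.
      by rewrite !gequiv inE => /eqP->.
    have : hs_act X x k^-1%g \in [set x | f x == y].
      by rewrite inE gequiv fx -gactM mulgV gact1.
    rewrite -gB => /imsetP[a aB xa]; exists a => //=.
    by rewrite gequiv -xa -gactM mulVg gact1.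
  apply/forall_inP=> _ /imsetP[a aB ->]; apply/forall_inP=> _ /imsetP[a' aB' ->].
  apply/implyP; rewrite !gequiv => /eqP/gact_inj gaa.
  by have /forall_inP/(_ a' aB')/implyP := injB a aB; rewrite gaa eqxx => /(_ isT)/eqP->.
pose E := sub_gset QEP.
pose QP (u : prod_gset A E) := u.1 \in (val u.2).2.
have QPP u k : QP u -> QP (hs_act (prod_gset A E) u k).
  by case: u => a c au; rewrite /QP /=; apply: imset_f.
pose P := sub_gset QPP.
pose h : hmap E Y := hm_comp (prod_fst _ _) (sub_incl QEP).
pose e : hmap P A := hm_comp (prod_fst _ _) (sub_incl QPP).
pose q : hmap P E := hm_comp (prod_snd _ _) (sub_incl QPP).
exists E, P, h, (hm_comp g e), q, e; split=> //.
- split=> [[[a [[y B] QB]] /= aB]|x [[y B] QB] /= fxy].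
    have /andP[/eqP/= gB _] := QB.
    have : g a \in [set x | f x == y] by rewrite -gB; apply: imset_f.
    by rewrite inE => /eqP.
  have /andP[/eqP/= gB /forall_inP injB] := QB.
  have : x \in [set x | f x == y] by rewrite inE fxy.
  rewrite -gB => /imsetP[a aB xa].
  exists (exist _ (a, exist _ (y, B) QB) aB); split=> //= -[[a' c'] aB'] /= [gaa cc].
  have aB1 : a' \in B by move: (aB'); rewrite /QP /= cc.
  apply: val_inj; rewrite /= cc; congr (_, _).
  by have /forall_inP/(_ a' aB1)/implyP := injB a aB; rewrite gaa xa eqxx => /(_ isT)/eqP.
- move=> y s sP.
  pose B := [set s x | x in {: {x : X | f x == y}}].
  have QB : QE (y, B).
    apply/andP; split=> /=.
      rewrite -imset_comp; apply/eqP/setP=> x; rewrite inE; apply/imsetP/idP=> [[u _ ->]|fx].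
        by rewrite /= sP (valP u).
      by exists (exist _ x fx) => //=; rewrite sP.
    apply/forall_inP=> _ /imsetP[a aB ->]; apply/forall_inP=> _ /imsetP[a' aB' ->].
    by apply/implyP; rewrite !sP => /eqP/val_inj->.
  exists (exist _ (y, B) QB); split=> [|[[y' B'] QB'] /= [yy eB]].
    split=> // -[[a c'] /= aB] x /= Ec' gax; rewrite /QP /= Ec' /= in aB.
    by case/imsetP: aB gax => x' _ ->; rewrite sP => /val_inj->.
  subst y'; apply: val_inj; congr (_, _) => /=.
  have /andP[/eqP/= gB _] := QB'.
  have BB' a : a \in B' -> exists2 x, g a = val x & a = s x.
    move=> aB.
    have : g a \in [set x | f x == y] by rewrite -gB; apply: imset_f.
    rewrite inE => fga; exists (exist _ (g a) fga) => //.
    exact: (eB (exist _ (a, exist _ (y, B') QB') aB) (exist _ (g a) fga)).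
  apply/setP=> a; apply/imsetP/idP=> [[x _ ->]|/BB'[x _ ->]]; last by exists x.
  have : val x \in [set x | f x == y] by rewrite inE (valP x).
  rewrite -gB => /imsetP[a' aB' xa'].
  by have [x' gx' ax'] := BB' _ aB'; move: aB';
    rewrite ax' (_ : x' = x) //; apply: val_inj; rewrite -gx'.
Qed.

Section Admissible.
Variable O : indexing_system gT.

Section TrivialHSet.
Variables (H : {group gT}) (T : finType).
Fact trivial_is_action : is_action H (fun (x : T) (_ : gT) => x).
Proof. by apply: conj => [h x y|x h h' _ _]. Qed.
Definition trivial_hset : hset H := HSet (Action trivial_is_action).
End TrivialHSet.

(** Sub-H-sets are finite limits: W is the pullback along true : 1 -> bool of the
    indicator function of its image, and trivial H-sets are in O. *)
Lemma adm_sub (H : {group gT}) (W S : hset H) (m : hmap W S) : injective m -> O H S -> O H W.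
Proof.
move=> m_inj OS.
have inv (s : S) : {in H, forall h,
    [exists w, m w == hs_act S s h] = [exists w, m w == s]}.
  move=> h hH; apply/existsP/existsP=> -[w /eqP mw].
    exists (hs_act W w h^-1%g); rewrite hm_equiv ?groupV // mw -(actMin (hs_act S)) ?groupV //.
    by rewrite mulgV act1.
  by exists (hs_act W w h); rewrite hm_equiv // mw.
pose chi : hmap S (trivial_hset H bool) :=
  HMap (inv : forall x, {in H, forall h, _ = hs_act (trivial_hset H bool) _ h}).
pose pt : hmap (trivial_hset H unit) (trivial_hset H bool) :=
  @HMap gT H (trivial_hset H unit) (trivial_hset H bool) (fun _ => true) (fun _ _ _ => erefl).
pose c : hmap W (trivial_hset H unit) :=
  @HMap gT H W (trivial_hset H unit) (fun _ => tt) (fun _ _ _ => erefl).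
apply: (@is_limit _ O H W S _ _ m c chi pt) => //; try by apply: is_triv.
split=> [w|s [] /existsP[w /eqP mw]] /=; first by apply/existsP; exists w.
by exists w; split=> // w' [mw' _]; apply: m_inj; rewrite mw.
Qed.

Lemma coset_act (H K : {group gT}) (u : coset_hset H K) h :
  h \in H -> val (hs_act (coset_hset H K) u h) = (val u :* h)%g.
Proof.
move=> hH; have hdom := subsetP (coset_act_dom H K) h hH.
by rewrite /= val_subact hdom /= rcosetE.
Qed.

(** In a pullback the stabilizer of w is the intersection of the stabilizers of its
    two projections, so the orbit of the stabilizer of q w through w embeds
    into the restriction of the orbit that f has at p w. *)
Lemma admissible_pullback X Y Z W (p : hmap W X) (q : hmap W Z) (f : hmap X Y) (g : hmap Z Y) :
  is_pullback p q f g -> admissible O f -> admissible O q.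
Proof.
move=> [pb_comm pb_uniq] af w.
(* K = stab (q w) is the group to which the orbit stab (f (p w)) / stab (p w) is restricted. *)
have sKH : stab (q w) \subset stab (f (p w)).
  apply/subsetP=> h /astab1P qh; apply/astab1P.
  by rewrite pb_comm -gequiv qh.
have sWX : stab w \subset stab (p w).
  by apply/subsetP=> h /astab1P wh; apply/astab1P; rewrite -gequiv wh.
have WE h : h \in stab (q w) -> h \in stab (p w) -> h \in stab w.
  move=> /astab1P qh /astab1P ph; apply/astab1P.
  have [v [_ v_uniq]] := pb_uniq (p w) (q w) (pb_comm w).
  by rewrite -[LHS]v_uniq -?[RHS]v_uniq // !gequiv ph qh.
move: (is_restriction sKH (af (p w))).
set S := restrict_hset _ _.
(* The embedding sends a coset of stab w to the coset of stab (p w) that contains it. *)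
have mP (u : coset_hset (stab (q w)) (stab w)) :
    (stab (p w) * val u)%g \in rcosets (stab (p w)) (stab (f (p w))).
  case: u => B /= /rcosetsP[k kK ->]; apply/rcosetsP; exists k; first exact: (subsetP sKH).
  by rewrite mulgA mulGSid.
pose m (u : coset_hset (stab (q w)) (stab w)) : S :=
  exist _ (stab (p w) * val u)%g (mP u).
have m_equiv u : {in stab (q w), forall h, m (hs_act _ u h) = hs_act S (m u) h}.
  move=> h hK; apply: val_inj; rewrite /= [in RHS]val_subact.
  have -> : h \in subact_dom (fun B : {set gT} => B \in rcosets (stab (p w)) (stab (f (p w)))) 'Rs.
    by apply: (subsetP (coset_act_dom _ _)); apply: (subsetP sKH).
  have := coset_act u hK; rewrite /= => ->.
  by rewrite /= rcosetE mulgA.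
apply: (@adm_sub _ _ _ (HMap m_equiv)) => u v /(congr1 val) /= muv; apply: val_inj.
have /rcosetsP[k kK uk] := valP u; have /rcosetsP[k' kK' vk'] := valP v.
move: muv; rewrite /= in uk vk' *; rewrite uk vk' !mulgA mulGSid // => kk.
have : k \in (stab (p w) :* k')%g by rewrite -kk rcoset_refl.
rewrite mem_rcoset => kkp; apply/rcoset_eqP; rewrite mem_rcoset.
by apply: WE => //; rewrite groupM ?groupV.
Qed.

End Admissible.
End GSets.

(** * Elements of a coproduct of Tambara functors *)

Lemma hmap_eq (gT : finGroupType) (H : {group gT}) (X Y : hset H) (f g : hmap X Y) :
  f =1 g -> f = g.
Proof.
case: f g => [f fE] [g gE] /= /funext fg; subst g.
by rewrite (Prop_irrelevance fE gE).
Qed.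

Section Mackey.

Variable gT : finGroupType.
Local Notation gset := (gset gT).

Section Splitting.
Variables (M : gset -> zmodType)
  (res : forall X Y : gset, hmap X Y -> {additive M Y -> M X})
  (tr : forall X Y : gset, hmap X Y -> {additive M X -> M Y}).
Hypothesis laws : mackey_laws (M := M) (fun X Y f => res f) (fun X Y f => tr f).
Variables (X Y U : gset) (i : hmap X U) (j : hmap Y U).

Lemma union_swap : is_disjoint_union i j -> is_disjoint_union j i.
Proof.
move=> [k ik ki]; exists (fun u => match k u with inl x => inr x | inr y => inl y end) => [[y|x]|u].
- by have := ik (inr y) => /= ->.
- by have := ik (inl x) => /= ->.
by have := ki u; case: (k u).
Qed.

Lemma res_tr_same : is_disjoint_union i j -> forall a, res i (tr i a) = a.
Proof.
move=> /bij_inj ij_inj a.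
have i_inj : injective i by move=> x x' /(ij_inj (inl x) (inl x')) [].
rewrite (@double_coset _ _ _ _ laws _ _ _ _ (hm_id X) (hm_id X) i i).
  by rewrite (res_id laws) (tr_id laws).
split=> // x z /i_inj xz; exists x; split=> //= w [-> _] //.
Qed.

(** By the double coset formula along the pullback of i and j, which is empty. *)
Lemma res_tr_other : is_disjoint_union i j -> forall b, res i (tr j b) = 0.
Proof.
move=> /bij_inj ij_inj b; have [W [p [q pb]]] := pullback_exists j i.
rewrite (double_coset laws pb) (empty_zero laws (res p b)) ?raddf0 //.
apply: eq_card0 => w; exfalso.
by have := ij_inj (inr (p w)) (inl (q w)) (proj1 pb w).
Qed.

End Splitting.

Lemma union_split (M : gset -> zmodType)
  (res : forall X Y : gset, hmap X Y -> {additive M Y -> M X})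
  (tr : forall X Y : gset, hmap X Y -> {additive M X -> M Y})
  (laws : mackey_laws (M := M) (fun X Y f => res _ _ f) (fun X Y f => tr _ _ f))
  (X Y U : gset) (i : hmap X U) (j : hmap Y U) : is_disjoint_union i j ->
  forall u, u = tr _ _ i (res _ _ i u) + tr _ _ j (res _ _ j u).
Proof.
move=> ij u; have ji := union_swap ij.
have [v [_ v_uniq]] := union_prod laws ij (res _ _ i u) (res _ _ j u).
rewrite -[LHS]v_uniq -?[RHS]v_uniq //; split; rewrite raddfD /=.
  by rewrite (res_tr_same laws ij) (res_tr_other laws ij) addr0.
by rewrite (res_tr_same laws ji) (res_tr_other laws ji) add0r.
Qed.

(** The laws pass to subfamilies stable under restrictions and transfers; the
    only existence statement among them, additivity on a disjoint union, is met
    by the sum of the two transfers. *)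
Lemma sub_mackey (M N : gset -> zmodType)
  (res : forall X Y : gset, hmap X Y -> {additive M Y -> M X})
  (tr : forall X Y : gset, hmap X Y -> {additive M X -> M Y})
  (resN : forall X Y : gset, hmap X Y -> N Y -> N X)
  (trN : forall X Y : gset, hmap X Y -> N X -> N Y)
  (incl : forall X, {additive N X -> M X}) :
  mackey_laws (M := M) (fun X Y f => res _ _ f) (fun X Y f => tr _ _ f) ->
  (forall X, injective (incl X)) ->
  (forall X Y (f : hmap X Y) n, incl X (resN _ _ f n) = res _ _ f (incl Y n)) ->
  (forall X Y (f : hmap X Y) n, incl Y (trN _ _ f n) = tr _ _ f (incl X n)) ->
  mackey_laws resN trN.
Proof.
move=> laws inj iR iT; split.
- by move=> X m; apply: inj; rewrite iR (res_id laws).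
- by move=> X Y Z g f m; apply: inj; rewrite !iR (res_comp laws).
- by move=> X m; apply: inj; rewrite iT (tr_id laws).
- by move=> X Y Z g f m; apply: inj; rewrite !iT (tr_comp laws).
- by move=> W X Z Y p q f g pb m; apply: inj; rewrite !(iR, iT) (double_coset laws pb).
- by move=> X m X0; apply: inj; rewrite [LHS](empty_zero laws) ?raddf0.
- move=> X Y U i j ij a b; have ji := union_swap ij.
  exists (trN _ _ i a + trN _ _ j b); split=> [|u [<- <-]].
    split; apply: inj; rewrite iR !(iT, raddfD) /=.
      by rewrite (res_tr_same laws ij) (res_tr_other laws ij) addr0.
    by rewrite (res_tr_same laws ji) (res_tr_other laws ji) add0r.
  by apply: inj; rewrite raddfD /= !(iT, iR) -(union_split laws ij).
Qed.

End Mackey.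

Section SubTambara.

Variables (gT : finGroupType) (O : indexing_system gT) (C : tambara O).
Variable D : forall X, C X -> Prop.
Arguments D {X} _.

(** The conditions under which D cuts out a sub-Tambara functor of C. *)
Record tambara_closed : Prop := TambaraClosed {
  tc_1 : forall X, D (1 : C X);
  tc_B : forall X (c d : C X), D c -> D d -> D (c - d);
  tc_M : forall X (c d : C X), D c -> D d -> D (c * d);
  tc_res : forall X Y (f : hmap X Y) (c : C Y), D c -> D (gr_res C f c);
  tc_tr : forall X Y (f : hmap X Y) (c : C X), D c -> D (gr_tr C f c);
  tc_nm : forall X Y (f : hmap X Y) (af : admissible O f) (c : C X), D c -> D (nm af c)
}.

Hypothesis closed : tambara_closed.

(** Subtypes need a boolean predicate, hence the excluded middle in [sub_pred]. *)
Definition sub_pred X : pred (C X) := fun c => `[< D c >].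
Definition sub_sort X := {c : C X | sub_pred c}.

Fact sub_pred_subring X : subring_closed (@sub_pred X).
Proof.
split; rewrite ?/in_mem /= /sub_pred.
- by apply/asboolP; apply: (tc_1 closed).
- by move=> c d /asboolP Dc /asboolP Dd; apply/asboolP; apply: (tc_B closed).
- by move=> c d /asboolP Dc /asboolP Dd; apply/asboolP; apply: (tc_M closed).
Qed.

HB.instance Definition _ X := SubChoice.on (sub_sort X).
HB.instance Definition _ X :=
  GRing.SubChoice_isSubComPzRing.Build _ _ (sub_sort X) (@sub_pred_subring X).

Definition sub_ob X : comPzRingType := sub_sort X.
Definition sub_val X : {rmorphism sub_ob X -> C X} := (val : sub_sort X -> C X).

Lemma sub_valP X (u : sub_ob X) : D (sub_val X u).
Proof. exact/asboolP/(valP (u : sub_sort X)). Qed.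

Definition sub_in X (c : C X) (Dc : D c) : sub_ob X := exist _ c (introT (asboolP _) Dc).

Lemma sub_val_inj X : injective (sub_val X).
Proof. exact: val_inj. Qed.

Section ResTr.
Variables (X Y : gset gT) (f : hmap X Y).
Definition sub_res (u : sub_ob Y) : sub_ob X := sub_in (tc_res closed f (sub_valP u)).
Definition sub_tr (u : sub_ob X) : sub_ob Y := sub_in (tc_tr closed f (sub_valP u)).
Fact sub_res_zmod : zmod_morphism sub_res.
Proof. by move=> u v; apply: val_inj; rewrite /= raddfB. Qed.
Fact sub_res_monoid : monoid_morphism sub_res.
Proof. by split=> [|u v]; apply: val_inj; rewrite /= (rmorph1, rmorphM). Qed.
Fact sub_tr_zmod : zmod_morphism sub_tr.
Proof. by move=> u v; apply: val_inj; rewrite /= raddfB. Qed.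
HB.instance Definition _ :=
  GRing.isZmodMorphism.Build (sub_ob Y) (sub_ob X) sub_res sub_res_zmod.
HB.instance Definition _ :=
  GRing.isMonoidMorphism.Build (sub_ob Y) (sub_ob X) sub_res sub_res_monoid.
HB.instance Definition _ :=
  GRing.isZmodMorphism.Build (sub_ob X) (sub_ob Y) sub_tr sub_tr_zmod.
End ResTr.

Fact sub_laws : mackey_laws (M := sub_ob) (fun X Y f => sub_res f) (fun X Y f => sub_tr f).
Proof.
by apply: (@sub_mackey gT (fun X => C X) (fun X => sub_ob X)
  (fun X Y f => gr_res C f) (fun X Y f => gr_tr C f)
  _ _ (fun X => sub_val X) (gr_laws C) sub_val_inj).
Qed.

Fact sub_frobenius X Y (f : hmap X Y) (b : sub_ob Y) (a : sub_ob X) :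
  sub_tr f (sub_res f b * a) = b * sub_tr f a.
Proof. by apply: val_inj; rewrite /= gr_frobenius. Qed.

Definition sub_green : green gT :=
  @Green gT sub_ob (fun X Y f => sub_res f) (fun X Y f => sub_tr f) sub_laws sub_frobenius.

Definition sub_nm X Y (f : hmap X Y) (af : admissible O f) (u : sub_green X) : sub_green Y :=
  sub_in (tc_nm closed af (sub_valP u)).

Definition sub_tambara : tambara O.
Proof.
apply: (@Tambara gT O sub_green sub_nm).
- by move=> X Y f af; apply: val_inj; rewrite /= nm_1.
- by move=> X Y f af u v; apply: val_inj; rewrite /= nm_M.
- by move=> X ai u; apply: val_inj; rewrite /= nm_id.
- by move=> X Y Z g f ag af agf u; apply: val_inj; rewrite /= (nm_comp ag af).
- by move=> X U i j f af ij fi fj u; apply: val_inj; rewrite /= (nm_fold af ij).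
- by move=> W X Z Y p q f g af aq pb u; apply: val_inj; rewrite /= (nm_double_coset af aq pb).
- by move=> X Y A E P f g h p q e af aq ex u; apply: val_inj; rewrite /= (nm_reciprocity af aq ex).
Defined.

Definition sub_gincl : gmap sub_tambara C :=
  @GMap gT sub_tambara C (fun X => sub_val X) (fun X Y f u => erefl) (fun X Y f u => erefl).

Definition sub_tincl : tmap sub_tambara C :=
  @TMap gT O sub_tambara C sub_gincl (fun X Y f af u => erefl).

Section Corestrict.
Variables (R : tambara O) (u : tmap R C).
Hypothesis uD : forall X (r : R X), D (u X r).

Definition corestr X (r : R X) : sub_tambara X := sub_in (uD r).
Fact corestr_zmod X : zmod_morphism (@corestr X).
Proof. by move=> r s; apply: val_inj; rewrite /= raddfB. Qed.
Fact corestr_monoid X : monoid_morphism (@corestr X).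
Proof. by split=> [|r s]; apply: val_inj; rewrite /= (rmorph1, rmorphM). Qed.
HB.instance Definition _ X :=
  GRing.isZmodMorphism.Build (R X) (sub_tambara X) (@corestr X) (@corestr_zmod X).
HB.instance Definition _ X :=
  GRing.isMonoidMorphism.Build (R X) (sub_tambara X) (@corestr X) (@corestr_monoid X).

Fact corestr_res X Y (f : hmap X Y) (r : R Y) :
  corestr (gr_res R f r) = gr_res sub_tambara f (corestr r).
Proof. by apply: val_inj; rewrite /= gm_res. Qed.
Fact corestr_tr X Y (f : hmap X Y) (r : R X) :
  corestr (gr_tr R f r) = gr_tr sub_tambara f (corestr r).
Proof. by apply: val_inj; rewrite /= gm_tr. Qed.
Definition corestr_gmap : gmap R sub_tambara :=
  @GMap gT R sub_tambara (fun X => @corestr X) corestr_res corestr_tr.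
Fact corestr_nm X Y (f : hmap X Y) (af : admissible O f) (r : R X) :
  corestr_gmap Y (nm af r) = nm af (corestr_gmap X r).
Proof. by apply: val_inj; rewrite /= tm_nm. Qed.
Definition corestrict : tmap R sub_tambara := TMap corestr_nm.

End Corestrict.

End SubTambara.

(** The universal property maps C to the sub-Tambara functor cut out by D, and
    the composite with the inclusion is the identity of C because it agrees
    with it on both summands. *)
Lemma coproduct_ind (gT : finGroupType) (O : indexing_system gT) (A B1 B2 C : tambara O)
    (f : tmap A B1) (g : tmap A B2) (i : tmap B1 C) (j : tmap B2 C)
    (D : forall X, C X -> Prop) :
  is_coproduct f g i j -> tambara_closed D ->
  (forall X (r : B1 X), D X (i X r)) -> (forall X (s : B2 X), D X (j X s)) ->
  forall X (c : C X), D X c.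
Proof.
move=> [ij cop] closed iD jD X c.
have [|w [wi wj] _] := cop _ (corestrict closed iD) (corestrict closed jD).
  by move=> Z z; apply: sub_val_inj; exact: (ij Z z).
have [v _ v_uniq] := cop _ i j ij.
have incl_w : tm_eq (tm_comp (sub_tincl closed) w) v.
  apply: v_uniq => Z z; first exact: (congr1 (sub_val closed Z) (wi Z z)).
  exact: (congr1 (sub_val closed Z) (wj Z z)).
have -> : c = sub_val closed X (w X c).
  by apply: (etrans (v_uniq (tm_id C) _ _ X c) (esym (incl_w X c))).
exact: sub_valP.
Qed.

Section CoproductElements.

Variables (gT : finGroupType) (O : indexing_system gT) (A B1 B2 C : tambara O).
Variables (f : tmap A B1) (g : tmap A B2) (i : tmap B1 C) (j : tmap B2 C).

Definition transfer_of_product X (c : C X) : Prop :=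
  exists Z (h : hmap Z X) (r : B1 Z) (s : B2 Z), c = gr_tr C h (i Z r * j Z s).

(** Transfers of products of elements of i and j are closed under all the
    operations of C; negation and sums need no linear combinations, since
    a sum of transfers is one transfer from a disjoint union. *)
Lemma transfer_of_product_closed : tambara_closed transfer_of_product.
Proof.
have cM Z X Y (h : hmap Z X) (k : hmap X Y) c : gr_tr C k (gr_tr C h c) = gr_tr C (hm_comp k h) c.
  by rewrite (tr_comp (gr_laws C)).
have cR X Y (k : hmap X Y) (c : C Y) : transfer_of_product c -> transfer_of_product (gr_res C k c).
  move=> [Z [h [r [s ->]]]]; have [W [p [q pb]]] := pullback_exists h k.
  exists W, q, (gr_res B1 p r), (gr_res B2 p s).
  by rewrite (double_coset (gr_laws C) pb) rmorphM !gm_res.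
have cT X Y (k : hmap X Y) (c : C X) : transfer_of_product c -> transfer_of_product (gr_tr C k c).
  by move=> [Z [h [r [s ->]]]]; exists Z, (hm_comp k h), r, s; rewrite cM.
split=> //.
- by move=> X; exists X, (hm_id X), 1, 1; rewrite !rmorph1 mulr1 (tr_id (gr_laws C)).
- move=> X c d [Z [h [r [s ->]]]] [Z' [h' [r' [s' ->]]]].
  have un := @sum_disjoint gT Z Z'.
  have [r2 [[r2l r2r] _]] := union_prod (gr_laws B1) un r (- r').
  have [s2 [[s2l s2r] _]] := union_prod (gr_laws B2) un s s'.
  exists (sum_gset Z Z'), (copair h h'), r2, s2.
  rewrite (union_split (gr_laws C) un (i _ r2 * j _ s2)) raddfD /= !cM.
  rewrite !rmorphM -!gm_res r2l r2r s2l s2r rmorphN mulNr raddfN /=.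
  have -> : hm_comp (copair h h') (sum_inl Z Z') = h by apply: hmap_eq.
  by have -> : hm_comp (copair h h') (sum_inr Z Z') = h' by apply: hmap_eq.
- move=> X c d [Z [h [r [s ->]]]] Dd; rewrite mulrC -gr_frobenius.
  apply: (cT _ _ h); have [W [k [r' [s' ->]]]] := cR _ _ h d Dd.
  rewrite mulrC -gr_frobenius; apply: (cT _ _ k).
  exists W, (hm_id W), (gr_res B1 k r * r'), (gr_res B2 k s * s').
  by rewrite (tr_id (gr_laws C)) !rmorphM !gm_res mulrACA.
- move=> X Y k ak c [Z [h [r [s ->]]]].
  have [E [P [e [p [q [ev ex]]]]]] := exponential_exists k h.
  have aq := admissible_pullback (exp_pullback ex) ak.
  rewrite (nm_reciprocity ak aq ex) rmorphM nm_M -!gm_res -!tm_nm.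
  by exists E, e, (nm aq (gr_res B1 ev r)), (nm aq (gr_res B2 ev s)).
Qed.

Lemma coproduct_transfer_of_product :
  is_coproduct f g i j -> forall X (c : C X), transfer_of_product c.
Proof.
move=> cop; apply: (coproduct_ind cop transfer_of_product_closed) => X x.
  by exists X, (hm_id X), x, 1; rewrite rmorph1 mulr1 (tr_id (gr_laws C)).
by exists X, (hm_id X), 1, x; rewrite rmorph1 mul1r (tr_id (gr_laws C)).
Qed.
End CoproductElements.

(** * Induction on relative box products *)

Section BuildMMap.

Variables (gT : finGroupType) (A : green gT) (M N : module A).
Variable h : forall X, M X -> N X.
Arguments h {X} _.
Hypotheses (hL : forall X, linear (@h X))
  (hR : forall X Y (f : hmap X Y) (m : M Y), h (md_res M f m) = md_res N f (h m))
  (hT : forall X Y (f : hmap X Y) (m : M X), h (md_tr M f m) = md_tr N f (h m)).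

Definition linear_component X (m : M X) : N X := h m.
HB.instance Definition _ X :=
  GRing.isLinear.Build (A X) (M X) (N X) _ (@linear_component X) (@hL X).

Definition build_mmap : mmap M N := @MMap gT A M N (fun X => @linear_component X) hR hT.

End BuildMMap.

Section Submodule.

Variables (gT : finGroupType) (A : green gT) (M : module A).
Variable D : forall X, M X -> Prop.
Arguments D {X} _.

Record module_closed : Prop := ModuleClosed {
  mc_0 : forall X, D (0 : M X);
  mc_D : forall X (m n : M X), D m -> D n -> D (m + n);
  mc_Z : forall X (a : A X) (m : M X), D m -> D (a *: m);
  mc_res : forall X Y (f : hmap X Y) (m : M Y), D m -> D (md_res M f m);
  mc_tr : forall X Y (f : hmap X Y) (m : M X), D m -> D (md_tr M f m)
}.

Hypothesis closed : module_closed.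

Definition subm_pred X : pred (M X) := fun m => `[< D m >].
Definition subm_sort X := {m : M X | subm_pred m}.

Fact subm_pred_closed X : GRing.subsemimod_closed (@subm_pred X).
Proof.
do !split; rewrite ?/in_mem /= /subm_pred.
- exact/asboolP/(mc_0 closed).
- by move=> m n /asboolP Dm /asboolP Dn; apply/asboolP; apply: (mc_D closed).
- by move=> a m /asboolP Dm; apply/asboolP; apply: (mc_Z closed).
Qed.

HB.instance Definition _ X := SubChoice.on (subm_sort X).
HB.instance Definition _ X :=
  GRing.SubChoice_isSubLmodule.Build _ _ _ (subm_sort X) (@subm_pred_closed X).

Definition subm_ob X : lmodType (A X) := subm_sort X.
Definition subm_val X : {linear subm_ob X -> M X} := (val : subm_sort X -> M X).

Lemma subm_valP X (u : subm_ob X) : D (subm_val X u).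
Proof. exact/asboolP/(valP (u : subm_sort X)). Qed.

Definition subm_in X (m : M X) (Dm : D m) : subm_ob X := exist _ m (introT (asboolP _) Dm).

Lemma subm_val_inj X : injective (subm_val X).
Proof. exact: val_inj. Qed.

Section ResTr.
Variables (X Y : gset gT) (f : hmap X Y).
Definition subm_res (u : subm_ob Y) : subm_ob X := subm_in (mc_res closed f (subm_valP u)).
Definition subm_tr (u : subm_ob X) : subm_ob Y := subm_in (mc_tr closed f (subm_valP u)).
Fact subm_res_zmod : zmod_morphism subm_res.
Proof. by move=> u v; apply: val_inj; rewrite /= raddfB. Qed.
Fact subm_tr_zmod : zmod_morphism subm_tr.
Proof. by move=> u v; apply: val_inj; rewrite /= raddfB. Qed.
HB.instance Definition _ :=
  GRing.isZmodMorphism.Build (subm_ob Y) (subm_ob X) subm_res subm_res_zmod.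
HB.instance Definition _ :=
  GRing.isZmodMorphism.Build (subm_ob X) (subm_ob Y) subm_tr subm_tr_zmod.
End ResTr.

Fact subm_laws : mackey_laws (M := subm_ob) (fun X Y f => subm_res f) (fun X Y f => subm_tr f).
Proof.
by apply: (@sub_mackey gT (fun X => M X) (fun X => subm_ob X)
  (fun X Y f => md_res M f) (fun X Y f => md_tr M f)
  _ _ (fun X => subm_val X) (md_laws M) subm_val_inj).
Qed.

Fact subm_resZ X Y (f : hmap X Y) (r : A Y) (m : subm_ob Y) :
  subm_res f (r *: m) = gr_res A f r *: subm_res f m.
Proof. by apply: val_inj; rewrite /= md_resZ. Qed.
Fact subm_frobenius_l X Y (f : hmap X Y) (r : A Y) (m : subm_ob X) :
  subm_tr f (gr_res A f r *: m) = r *: subm_tr f m.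
Proof. by apply: val_inj; rewrite /= md_frobenius_l. Qed.
Fact subm_frobenius_r X Y (f : hmap X Y) (r : A X) (m : subm_ob Y) :
  subm_tr f (r *: subm_res f m) = gr_tr A f r *: m.
Proof. by apply: val_inj; rewrite /= md_frobenius_r. Qed.

Definition submodule : module A :=
  @Module gT A subm_ob (fun X Y f => subm_res f) (fun X Y f => subm_tr f)
    subm_laws subm_resZ subm_frobenius_l subm_frobenius_r.

Definition subm_incl : mmap submodule M :=
  @MMap gT A submodule M (fun X => subm_val X) (fun X Y f u => erefl) (fun X Y f u => erefl).

End Submodule.

Section BoxInduction.

Variables (gT : finGroupType) (A : green gT) (M N T : module A) (beta : pairing M N T).
Hypothesis box : is_box beta.

(** The universal pairing factors through the submodule cut out by D; composed with
    the inclusion, the induced map is a second endomorphism of T that fixes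
    the pure tensors, hence the identity. *)
Lemma box_ind (D : forall X, T X -> Prop) : module_closed D ->
  (forall X (m : M X) (n : N X), D X (beta X m n)) -> forall X (t : T X), D X t.
Proof.
move=> closed Dbeta X t.
pose g X (m : M X) (n : N X) : submodule closed X := subm_in closed (Dbeta X m n).
have gDl Y (m m' : M Y) (n : N Y) : g Y (m + m') n = g Y m n + g Y m' n.
  by apply: val_inj; rewrite /= pr_Dl.
have gDr Y (m : M Y) (n n' : N Y) : g Y m (n + n') = g Y m n + g Y m n'.
  by apply: val_inj; rewrite /= pr_Dr.
have gZl Y a (m : M Y) (n : N Y) : g Y (a *: m) n = a *: g Y m n.
  by apply: val_inj; rewrite /= pr_Zl.
have gZr Y a (m : M Y) (n : N Y) : g Y m (a *: n) = a *: g Y m n.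
  by apply: val_inj; rewrite /= pr_Zr.
have gR Y Z (f : hmap Y Z) (m : M Z) (n : N Z) :
    g Y (md_res M f m) (md_res N f n) = md_res (submodule closed) f (g Z m n).
  by apply: val_inj; rewrite /= pr_res.
have gl Y Z (f : hmap Y Z) (m : M Y) (n : N Z) :
    g Z (md_tr M f m) n = md_tr (submodule closed) f (g Y m (md_res N f n)).
  by apply: val_inj; rewrite /= pr_frobenius_l.
have gr Y Z (f : hmap Y Z) (m : M Z) (n : N Y) :
    g Z m (md_tr N f n) = md_tr (submodule closed) f (g Y (md_res M f m) n).
  by apply: val_inj; rewrite /= pr_frobenius_r.
have [h hbeta _] := box (Pairing gDl gDr gZl gZr gR gl gr).
have hL Y : linear (fun t : T Y => subm_val closed Y (h Y t)).
  by move=> a u v; rewrite !linearP.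
have hR Y Z (f : hmap Y Z) (u : T Z) :
    subm_val closed Y (h Y (md_res T f u)) = md_res T f (subm_val closed Z (h Z u)).
  by rewrite mm_res.
have hT Y Z (f : hmap Y Z) (u : T Y) :
    subm_val closed Z (h Z (md_tr T f u)) = md_tr T f (subm_val closed Y (h Y u)).
  by rewrite mm_tr.
have [k _ k_uniq] := box beta.
have -> : t = subm_val closed X (h X t).
  have idL Y : linear (@id (T Y)) by [].
  rewrite [RHS](k_uniq (build_mmap hL hR hT)) => [|Y m n].
    by apply: (k_uniq (build_mmap idL (fun X Y f m => erefl) (fun X Y f m => erefl))).
  by rewrite /= /linear_component hbeta.
exact: subm_valP.
Qed.

End BoxInduction.

Section BoxLinear.

Variables (gT : finGroupType) (A B : green gT) (phi : gmap A B).
Variables (M N : module A) (T V : module B).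
Variables (beta : pairing M N (restrict phi T)) (gamma : pairing M N (restrict phi V)).
Hypothesis box : is_box beta.

(** The box product over A of two modules may carry an action of a larger Green
    functor B, which its universal property does not see.  The elements t such
    that h is B-linear on all restrictions of t form an A-submodule: for
    closure under transfers, push c * T_g t forward along the pullback of the
    two maps, by Frobenius reciprocity.  So it is enough to look at pure tensors. *)
Lemma box_linear_map :
  (forall h : mmap (restrict phi T) (restrict phi V),
     (forall X m n, h X (beta X m n) = gamma X m n) ->
     forall X (c : B X) m n,
       h X (c *: (beta X m n : T X)) = c *: (gamma X m n : V X)) ->
  exists h : mmap T V, forall X m n, h X (beta X m n) = gamma X m n.
Proof.
move=> pureZ; have [h hbeta _] := box gamma.
have {}pureZ := pureZ h hbeta.
pose D X (t : restrict phi T X) :=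
  forall Z (f : hmap Z X) (c : B Z),
    h Z (c *: (md_res T f t : T Z)) = c *: (md_res V f (h X t) : V Z).
have h0 X : h X (0 : T X) = (0 : V X) := raddf0 (h X).
have hD X (t u : T X) : h X (t + u : T X) = (h X t + h X u : V X) := raddfD (h X) t u.
have hZ X a (t : T X) : h X (phi X a *: t : T X) = phi X a *: (h X t : V X) := linearZZ (h X) a t.
have closed : module_closed D.
  split.
  - move=> X Z f c.
    by rewrite h0 (raddf0 (md_res T f)) scaler0 h0 (raddf0 (md_res V f)) scaler0.
  - move=> X t u Dt Du Z f c; rewrite hD (raddfD (md_res T f)) scalerDr hD Dt Du.
    by rewrite (raddfD (md_res V f)) scalerDr.
  - move=> X a t Dt Z f c.
    change (h Z (c *: md_res T f (phi X a *: (t : T X))) =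
            c *: (md_res V f (h X (phi X a *: (t : T X) : T X) : V X) : V Z)).
    by rewrite hZ !md_resZ !scalerA !(mulrC c) -!scalerA -gm_res hZ Dt.
  - move=> X Y g t Dt Z f c; rewrite mm_res -!(res_comp (md_laws T)).
    by rewrite -!(res_comp (md_laws V)); apply: Dt.
  - move=> X Y g t Dt Z f c; have [W [p [q pb]]] := pullback_exists g f.
    rewrite mm_tr (double_coset (md_laws T) pb) (double_coset (md_laws V) pb).
    rewrite -!md_frobenius_l -Dt.
    exact: (mm_tr h q).
have {}hZ X (c : B X) (t : T X) : h X (c *: t) = c *: (h X t : V X).
  suff: D X t by move/(_ _ (hm_id X) c); rewrite (res_id (md_laws T)) (res_id (md_laws V)).
  move: X c t => X _; apply: (box_ind box closed) => Y m n Z f d.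
  rewrite hbeta -[md_res T f _](pr_res beta) -[md_res V f _](pr_res gamma).
  exact: pureZ.
have hL X : linear (h X : T X -> V X) by move=> c t u; rewrite raddfD /= hZ.
exists (build_mmap hL (mm_res h) (mm_tr h)); exact: hbeta.
Qed.

End BoxLinear.

(** * Functoriality of Kaehler differentials *)

Lemma coproduct_map_eq (gT : finGroupType) (O : indexing_system gT) (A B1 B2 C D : tambara O)
    (f : tmap A B1) (g : tmap A B2) (i : tmap B1 C) (j : tmap B2 C) (u v : tmap C D) :
  is_coproduct f g i j -> tm_eq (tm_comp u i) (tm_comp v i) ->
  tm_eq (tm_comp u j) (tm_comp v j) -> tm_eq u v.
Proof.
move=> [ij cop] ui uj.
have [|w _ w_uniq] := cop D (tm_comp v i) (tm_comp v j).
  by move=> X x; apply: (congr1 (v X) (ij X x)).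
move=> X c; apply: (etrans (w_uniq u ui uj X c) (esym (w_uniq v _ _ X c))) => //.
Qed.

(** The preimage under psi of an ideal is an ideal, as a kernel of a composite, and
    psi commutes with norms. *)
Lemma power_gt1_map (gT : finGroupType) (O : indexing_system gT) (S' S : tambara O)
    (psi : tmap S' S) (I' : forall X, S' X -> Prop) (I : forall X, S X -> Prop) :
  (forall X s, I' X s -> I X (psi X s)) ->
  forall X s, power_gt1 I' s -> power_gt1 I (psi X s).
Proof.
move=> II X s I's J [T [u uJ]] IJ.
apply: (I's (fun Y (t : S' Y) => J Y (psi Y t))).
  by exists T, (tm_comp u psi) => Y t; apply: uJ.
by move=> Y Z f af f2 t I't; rewrite tm_nm; apply: IJ => //; apply: II.
Qed.

Section Conormal.

Variables (gT : finGroupType) (O : indexing_system gT) (P' P C' C : tambara O).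
Variables (mu' : tmap C' P') (mu : tmap C P) (phi : tmap P' P) (psi : tmap C' C).
Variables (l' : tmap P' C').
Variables (Om' : module P') (Om : module P).
Variables (q' : forall X, kernel mu' X -> Om' X) (q : forall X, kernel mu X -> Om X).
Arguments q' {X} _.
Arguments q {X} _.
Hypotheses (con' : is_conormal (@q')) (con : is_conormal (@q)).
Hypotheses (mupsi : tm_eq (tm_comp mu psi) (tm_comp phi mu'))
  (mul' : tm_eq (tm_comp mu' l') (tm_id P')).

(** The section l' of mu' is used to write the scalars of P' as images of elements of
    C', where the quotient map is linear by construction. *)
Lemma conormal_map : exists w : mmap Om' (restrict phi Om),
  forall X (x : kernel mu' X) (y : kernel mu X), val y = psi X (val x) -> w X (q' x) = q y.
Proof.
have ker_psi X (x : kernel mu' X) : mu X (psi X (val x)) == 0.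
  by have /= -> := mupsi (val x); rewrite (eqP (valP x)) raddf0.
pose im X (x : kernel mu' X) : kernel mu X := exist _ (psi X (val x)) (ker_psi X x).
have qE X (y z : kernel mu X) : val y = val z -> q y = q z.
  by move=> yz; congr (q _); apply: val_inj.
have subK X (x x' : kernel mu' X) : mu' X (val x - val x') == 0.
  by rewrite raddfB /= (eqP (valP x)) (eqP (valP x')) subrr.
have addK X (x x' : kernel mu' X) : mu' X (val x + val x') == 0.
  by rewrite raddfD /= (eqP (valP x)) (eqP (valP x')) addr0.
have mulK X c (x : kernel mu' X) : mu' X (c * val x) == 0.
  by rewrite rmorphM /= (eqP (valP x)) mulr0.
have resK X Y (f : hmap X Y) (x : kernel mu' Y) : mu' X (gr_res C' f (val x)) == 0.
  by rewrite gm_res (eqP (valP x)) raddf0.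
have trK X Y (f : hmap X Y) (x : kernel mu' X) : mu' Y (gr_tr C' f (val x)) == 0.
  by rewrite gm_tr (eqP (valP x)) raddf0.
have wd X (x x' : kernel mu' X) : q' x = q' x' -> q (im X x) = q (im X x').
  move=> xx; pose d : kernel mu' X := exist _ (val x - val x') (subK X x x').
  have qd : q' d = 0.
    by apply: (addIr (q' x')); rewrite add0r -[RHS]xx;
      rewrite -(cn_D con' (x := d) (y := x') (z := x)) /= ?subrK.
  have : q (im X d) = 0.
    apply/(cn_ker con); apply: power_gt1_map (iffLR (cn_ker con' d) qd) => Y s /= s0.
    by have /= -> := mupsi s; rewrite s0 raddf0.
  rewrite (cn_D con (x := im X d) (y := im X x') (z := im X x)) => [->|/=].
    by rewrite add0r.
  by rewrite raddfB /= subrK.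
pose rep X (m : Om' X) : kernel mu' X := sval (cid (cn_surj con' m)).
have repK X m : q' (rep X m) = m by rewrite /rep; case: cid.
pose w X (m : Om' X) : restrict phi Om X := q (im X (rep X m)).
have wE X x : w X (q' x) = q (im X x) by apply: wd; rewrite repK.
pose addX X (x x' : kernel mu' X) : kernel mu' X := exist _ (val x + val x') (addK X x x').
pose mulX X c (x : kernel mu' X) : kernel mu' X := exist _ (c * val x) (mulK X c x).
pose resX X Y f (x : kernel mu' Y) : kernel mu' X := exist _ (gr_res C' f (val x)) (resK X Y f x).
pose trX X Y f (x : kernel mu' X) : kernel mu' Y := exist _ (gr_tr C' f (val x)) (trK X Y f x).
have wD X m n : w X (m + n) = w X m + w X n.
  have [x <-] := cn_surj con' m; have [y <-] := cn_surj con' n.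
  rewrite -(cn_D con' (x := x) (y := y) (z := addX X x y)) // !wE.
  by apply: (cn_D con); rewrite /= raddfD.
have wZ X a m : w X (a *: m) = phi X a *: (w X m : Om X).
  have [x <-] := cn_surj con' m; have /= l'a := mul' a.
  rewrite -[in LHS]l'a -(cn_Z con' (x := x) (z := mulX X (l' X a) x)) // !wE.
  rewrite (cn_Z con (c := psi X (l' X a)) (x := im X x)) /= ?rmorphM //.
  by have /= -> := mupsi (l' X a); rewrite l'a.
have wL X : linear (w X) by move=> a m n; rewrite wD wZ.
have wR X Y (f : hmap X Y) m : w X (md_res Om' f m) = md_res Om f (w Y m).
  have [x <-] := cn_surj con' m.
  rewrite -(cn_res con' (x := resX X Y f x) (y := x)) // !wE.
  by apply: (cn_res con); rewrite /= gm_res.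
have wT X Y (f : hmap X Y) m : w Y (md_tr Om' f m) = md_tr Om f (w X m).
  have [x <-] := cn_surj con' m.
  rewrite -(cn_tr con' (x := x) (y := trX X Y f x)) // !wE.
  by apply: (cn_tr con); rewrite /= gm_tr.
exists (build_mmap wL wR wT) => X x y xy.
by rewrite /= /linear_component wE; apply: qE.
Qed.

End Conormal.

Section KaehlerFunctoriality.

Variables (gT : finGroupType) (O : indexing_system gT) (A' A : tambara O).
Variables (P' P : stambara O) (i' : stmap (const A') P') (i : stmap (const A) P).
Variables (a : tmap A' A) (phi : stmap P' P) (K' : kaehler i') (K : kaehler i).
Hypothesis square : stm_eq (stm_comp phi i') (stm_comp i (const_map a)).

Lemma square_map : exists psi : stmap (ka_square K') (ka_square K),
  stm_eq (stm_comp psi (ka_l K')) (stm_comp (ka_l K) phi) /\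
  stm_eq (stm_comp psi (ka_r K')) (stm_comp (ka_r K) phi).
Proof.
have ex n : exists w : tmap (ka_square K' n) (ka_square K n),
    tm_eq (tm_comp w (ka_l K' n)) (tm_comp (ka_l K n) (phi n)) /\
    tm_eq (tm_comp w (ka_r K' n)) (tm_comp (ka_r K n) (phi n)).
  have [_ cop] := ka_coproduct K' n.
  have [|w ww _] := cop _ (tm_comp (ka_l K n) (phi n)) (tm_comp (ka_r K n) (phi n)).
    move=> X x; have /= e := square x.
    by rewrite /= e; apply: (proj1 (ka_coproduct K n)).
  by exists w.
pose psi n := sval (cid (ex n)).
have psil n : tm_eq (tm_comp (psi n) (ka_l K' n)) (tm_comp (ka_l K n) (phi n)).
  exact: (proj1 (svalP (cid (ex n)))).
have psir n : tm_eq (tm_comp (psi n) (ka_r K' n)) (tm_comp (ka_r K n) (phi n)).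
  exact: (proj2 (svalP (cid (ex n)))).
have nat m n (u : {omorphism 'I_m.+1 -> 'I_n.+1}) :
    tm_eq (tm_comp (psi m) (st_map (ka_square K') u)) (tm_comp (st_map (ka_square K) u) (psi n)).
  apply: (coproduct_map_eq (ka_coproduct K' n)) => X x /=.
    have /= <- := stm_nat (ka_l K') u x; have /= -> := psil m X (st_map P' u X x).
    have /= -> := psil n X x; have /= -> := stm_nat phi u x.
    exact: (stm_nat (ka_l K) u (phi n X x)).
  have /= <- := stm_nat (ka_r K') u x; have /= -> := psir m X (st_map P' u X x).
  have /= -> := psir n X x; have /= -> := stm_nat phi u x.
  exact: (stm_nat (ka_r K) u (phi n X x)).
by exists (STMap nat).
Qed.

Lemma square_map_mu (psi : stmap (ka_square K') (ka_square K)) :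
  stm_eq (stm_comp psi (ka_l K')) (stm_comp (ka_l K) phi) ->
  stm_eq (stm_comp psi (ka_r K')) (stm_comp (ka_r K) phi) ->
  stm_eq (stm_comp (ka_mu K) psi) (stm_comp phi (ka_mu K')).
Proof.
move=> psil psir n; apply: (coproduct_map_eq (ka_coproduct K' n)) => X x /=.
  have /= -> := psil n X x; have /= -> := ka_mul K (phi n X x).
  by have /= -> := ka_mul K' x.
have /= -> := psir n X x; have /= -> := ka_mur K (phi n X x).
by have /= -> := ka_mur K' x.
Qed.

Lemma kaehler_map (psi : stmap (ka_square K') (ka_square K)) :
  stm_eq (stm_comp psi (ka_l K')) (stm_comp (ka_l K) phi) ->
  stm_eq (stm_comp psi (ka_r K')) (stm_comp (ka_r K) phi) ->
  exists w : smmap phi (ka_omega K') (ka_omega K),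
    forall n X (x : kernel (ka_mu K' n) X) (y : kernel (ka_mu K n) X),
      val y = psi n X (val x) -> w n X (ka_q x) = ka_q y.
Proof.
move=> psil psir; have mupsi := square_map_mu psil psir.
have ex n := conormal_map (ka_conormal K' n) (ka_conormal K n) (mupsi n) (ka_mul K' (n := n)).
pose w n := sval (cid (ex n)).
have wE n X (x : kernel (ka_mu K' n) X) (y : kernel (ka_mu K n) X) :
    val y = psi n X (val x) -> w n X (ka_q x) = ka_q y.
  exact: (svalP (cid (ex n))).
have nat m n (u : {omorphism 'I_m.+1 -> 'I_n.+1}) X (o : ka_omega K' n X) :
    w m X (sm_map (ka_omega K') u X o) = sm_map (ka_omega K) u X (w n X o).
  have [x <-] := cn_surj (ka_conormal K' n) o.
  have im k (z : kernel (ka_mu K' k) X) : ka_mu K k X (psi k X (val z)) == 0.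
    by have /= -> := mupsi k X (val z); rewrite (eqP (valP z)) raddf0.
  have ux : ka_mu K' m X (st_map (ka_square K') u X (val x)) == 0.
    by have /= -> := stm_nat (ka_mu K') u (val x); rewrite (eqP (valP x)) raddf0.
  pose x' : kernel (ka_mu K' m) X := exist _ (st_map (ka_square K') u X (val x)) ux.
  pose y : kernel (ka_mu K n) X := exist _ (psi n X (val x)) (im n x).
  pose y' : kernel (ka_mu K m) X := exist _ (psi m X (val x')) (im m x').
  rewrite -(ka_nat (y := x')) // (wE _ _ x' y') //.
  rewrite (wE _ _ x y) //.
  by apply: ka_nat; apply: (stm_nat psi u).
by exists (SMMap nat).
Qed.

End KaehlerFunctoriality.

(** * Maps of cotangent complexes and their base change *)

(** An iterated restriction of scalars is not convertible to the restriction along the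
    composite, so composites of semilinear maps are rebuilt. *)
Lemma semilinear_comp (gT : finGroupType) (A B C : green gT)
    (u : gmap A B) (v : gmap B C) (w : gmap A C) (M : module A) (N : module B) (P : module C)
    (h : mmap M (restrict u N)) (k : mmap N (restrict v P)) :
  (forall X a, w X a = v X (u X a)) ->
  exists g : mmap M (restrict w P), forall X m, g X m = k X (h X m).
Proof.
move=> wE; pose g X (m : M X) : restrict w P X := k X (h X m).
have gL X : linear (g X).
  move=> a m n; apply: (etrans (congr1 (k X) (linearP (h X) a m n))).
  apply: (etrans (linearP (k X) (u X a) (h X m) (h X n))).
  by rewrite [in LHS]/GRing.scale /= /restr_scale -wE.
have gR X Y (f : hmap X Y) m : g X (md_res M f m) = md_res (restrict w P) f (g Y m).
  by rewrite /g mm_res; apply: (mm_res k).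
have gT' X Y (f : hmap X Y) m : g Y (md_tr M f m) = md_tr (restrict w P) f (g X m).
  by rewrite /g mm_tr; apply: (mm_tr k).
by exists (build_mmap gL gR gT').
Qed.

Lemma box_map_eq (gT : finGroupType) (A B : green gT) (phi : gmap A B) (M N : module A)
    (T U : module B) (beta : pairing M N (restrict phi T)) (h k : mmap T U) : is_box beta ->
  (forall X m n, h X (beta X m n) = k X (beta X m n)) -> forall X (t : T X), h X t = k X t.
Proof.
move=> box hk; apply: (box_ind box) => //; split.
- by move=> X; rewrite (raddf0 (h X)) (raddf0 (k X)).
- move=> X t u ht hu; apply: (etrans (raddfD (h X) t u)).
  by apply: (etrans _ (esym (raddfD (k X) t u))); congr (_ + _).
- move=> X a t ht; apply: (etrans (linearZZ (h X) (phi X a) t)).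
  by apply: (etrans _ (esym (linearZZ (k X) (phi X a) t))); congr (_ *: _).
- move=> X Y f t ht; apply: (etrans (mm_res h f t)).
  exact: (etrans (congr1 (md_res U f) ht) (esym (mm_res k f t))).
- move=> X Y f t ht; apply: (etrans (mm_tr h f t)).
  exact: (etrans (congr1 (md_tr U f) ht) (esym (mm_tr k f t))).
Qed.

Section CotangentMap.

Variables (gT : finGroupType) (O : indexing_system gT) (R' S' R S : tambara O).
Variables (f' : tmap R' S') (f : tmap R S) (b : tmap S' S).
Variables (L' : cotangent_complex f') (L : cotangent_complex f).
Variables (phi : stmap (cc_P L') (cc_P L)).
Hypothesis lift : stm_eq (stm_comp (cc_p L) phi) (stm_comp (const_map b) (cc_p L')).
Variable w : smmap phi (ka_omega (cc_kaehler L')) (ka_omega (cc_kaehler L)).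

(** The pairing (o, s) |-> w o (x) b s is P'-bilinear as p o phi = b o p'; the map that it
    induces is S'-linear because S' acts through the second factor. *)
Lemma cotangent_map_level n : exists h : mmap (cc_L L' n) (restrict b (cc_L L n)),
  forall X o s, h X (cc_pair L' n X o s) = cc_pair L n X (w n X o) (b X s).
Proof.
pose V : module S' := restrict b (cc_L L n).
pose g X (o : ka_omega (cc_kaehler L') n X) (s : restrict (cc_p L' n) (self S') X) :
  restrict (cc_p L' n) V X := cc_pair L n X (w n X o) (b X s).
have gDl X o o' s : g X (o + o') s = g X o s + g X o' s.
  by rewrite /g (raddfD (w n X)); apply: (pr_Dl (cc_pair L n)).
have gDr X o s s' : g X o (s + s') = g X o s + g X o s'.
  apply: (etrans (congr1 (cc_pair L n X (w n X o)) (raddfD (b X) s s'))).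
  exact: (pr_Dr (cc_pair L n)).
have pE X (a : cc_P L' n X) : cc_p L n X (phi n X a) = b X (cc_p L' n X a) := lift a.
have gZl X a o s : g X (a *: o) s = a *: g X o s.
  apply: (etrans (congr1 (fun z => cc_pair L n X z (b X s)) (linearZZ (w n X) a o))).
  apply: (etrans (pr_Zl (cc_pair L n) (phi n X a) (w n X o) (b X s))).
  by rewrite [in LHS]/GRing.scale /= /restr_scale pE.
have gZr X a o s : g X o (a *: s) = a *: g X o s.
  have bs : b X (cc_p L' n X a * s) = cc_p L n X (phi n X a) * b X s by rewrite rmorphM pE.
  apply: (etrans (congr1 (cc_pair L n X (w n X o)) bs)).
  apply: (etrans (pr_Zr (cc_pair L n) (phi n X a) (w n X o) (b X s))).
  by rewrite [in LHS]/GRing.scale /= /restr_scale pE.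
have gR X Y (k : hmap X Y) o s :
    g X (md_res _ k o) (md_res _ k s) = md_res (restrict (cc_p L' n) V) k (g Y o s).
  apply: (etrans _ (pr_res (cc_pair L n) k (w n Y o) (b Y s))).
  by rewrite /g mm_res; congr (cc_pair L n _ _ _); apply: gm_res.
have gl X Y (k : hmap X Y) o s :
    g Y (md_tr _ k o) s = md_tr (restrict (cc_p L' n) V) k (g X o (md_res _ k s)).
  rewrite /g mm_tr; apply: (etrans (pr_frobenius_l (cc_pair L n) k (w n X o) (b Y s))).
  by congr (md_tr _ _ (cc_pair L n _ _ _)); apply: esym; apply: gm_res.
have gr X Y (k : hmap X Y) o s :
    g Y o (md_tr _ k s) = md_tr (restrict (cc_p L' n) V) k (g X (md_res _ k o) s).
  rewrite /g mm_res; apply: (etrans _ (pr_frobenius_r (cc_pair L n) k (w n Y o) (b X s))).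
  by congr (cc_pair L n _ _ _); apply: gm_tr.
have := @box_linear_map gT _ _ (cc_p L' n) _ _ (cc_L L' n) V _ (Pairing gDl gDr gZl gZr gR gl gr)
  (@cc_box _ _ _ _ _ L' n).
apply=> h hE X c o s.
have -> : c *: (cc_pair L' n X o s : cc_L L' n X) = cc_pair L' n X o (c * s).
  by rewrite cc_linear.
rewrite hE; apply: (etrans (congr1 (cc_pair L n X (w n X o)) (rmorphM (b X) c s))).
exact: (cc_linear (c := L)).
Qed.

Lemma cotangent_map : exists h : smmap (const_map b) L' L,
  forall n X o s, h n X (cc_pair L' n X o s) = cc_pair L n X (w n X o) (b X s).
Proof.
pose h n := sval (cid (cotangent_map_level n)).
have hE n X o s : h n X (cc_pair L' n X o s) = cc_pair L n X (w n X o) (b X s).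
  exact: (svalP (cid (cotangent_map_level n))).
have nat m n (u : {omorphism 'I_m.+1 -> 'I_n.+1}) X (x : cc_L L' n X) :
    h m X (sm_map (cc_L L') u X x) = sm_map (cc_L L) u X (h n X x).
  have [g gE] := @semilinear_comp gT S' S' S (gm_id S') b b _ _ _
    (sm_map (cc_L L') u) (h m) (fun _ _ => erefl).
  have [k kE] := @semilinear_comp gT S' S S b (gm_id S) b _ _ _
    (h n) (sm_map (cc_L L) u) (fun _ _ => erefl).
  rewrite -gE -kE; apply: (box_map_eq (@cc_box _ _ _ _ _ L' n)) => Y o s.
  by rewrite gE kE -cc_nat !hE -cc_nat smm_nat.
by exists (@SMMap gT O (const S') (const S) (const_map b) L' L h nat).
Qed.

End CotangentMap.

Section BaseChange.

Variables (gT : finGroupType) (O : indexing_system gT) (R' S' R S C : tambara O).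
Variables (a : tmap R' R) (f' : tmap R' S') (f : tmap R S) (b : tmap S' S).
Variables (i : tmap R C) (j : tmap S' C) (kappa : tmap C S).
Hypothesis coprod : is_coproduct a f' i j.
Hypotheses (kappa_i : tm_eq (tm_comp kappa i) f) (kappa_j : tm_eq (tm_comp kappa j) b).
Variables (M : smodule (const S')) (N : smodule (const S)) (T : base_change a f' i j M).
Variable lam : smmap (const_map b) M N.

(** The pairing (r, m) |-> f r * lam m is R'-bilinear.  An element c = T_k (i r1 * j s1)
    of C acts on r (x) m by T_k ((r1 * res r) (x) (s1 * res m)), and there the map is
    visibly compatible with kappa. *)
Lemma base_change_map_level n : exists h : mmap (bc_mod T n) (restrict kappa (N n)),
  forall X r m, h X (bc_pair T n X r m) = f X r *: (lam n X m : N n X).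
Proof.
pose V : module C := restrict kappa (N n).
have ki X r : kappa X (i X r) = f X r := kappa_i r.
have kj X s : kappa X (j X s) = b X s := kappa_j s.
have lamZ X s m : lam n X (s *: m) = b X s *: (lam n X m : N n X) := linearZZ (lam n X) s m.
pose g X (r : restrict a (self R) X) (m : restrict f' (M n) X) : restrict (tm_comp i a) V X :=
  f X r *: (lam n X m : N n X).
have gDl X r r' m : g X (r + r') m = g X r m + g X r' m.
  by apply: (etrans (congr1 (fun z => z *: _) (raddfD (f X) r r'))); apply: scalerDl.
have gDr X r m m' : g X r (m + m') = g X r m + g X r m'.
  by apply: (etrans (congr1 (fun z => f X r *: z) (raddfD (lam n X) m m'))); apply: scalerDr.
have gZl X c r m : g X (c *: r) m = c *: g X r m.
  have fr : f X (a X c * r) = kappa X (i X (a X c)) * f X r by rewrite rmorphM ki.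
  apply: (etrans (congr1 (fun z => z *: (lam n X m : N n X)) fr)).
  exact: (esym (scalerA _ _ _)).
have gZr X c r m : g X r (c *: m) = c *: g X r m.
  apply: (etrans (congr1 (fun z => f X r *: z) (lamZ X (f' X c) m))).
  have -> : b X (f' X c) = kappa X (i X (a X c)).
    rewrite -kj; congr (kappa X _); exact: (esym (proj1 coprod X c)).
  apply: (etrans (scalerA _ _ _)); rewrite mulrC; exact: (esym (scalerA _ _ _)).
have gR X Y (k : hmap X Y) r m :
    g X (md_res _ k r) (md_res _ k m) = md_res (restrict (tm_comp i a) V) k (g Y r m).
  apply: (etrans _ (esym (md_resZ k (f Y r) (lam n Y m : N n Y)))).
  by apply: (congr2 (fun z t => z *: (t : N n X)) (gm_res f k r) (mm_res (lam n) k m)).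
have gl X Y (k : hmap X Y) r m :
    g Y (md_tr _ k r) m = md_tr (restrict (tm_comp i a) V) k (g X r (md_res _ k m)).
  apply: (etrans (congr1 (fun z => z *: (lam n Y m : N n Y)) (gm_tr f k r))).
  apply: (etrans (esym (md_frobenius_r k (f X r) (lam n Y m : N n Y)))).
  by congr (md_tr _ _ (_ *: _)); apply: (esym (mm_res (lam n) k m)).
have gr X Y (k : hmap X Y) r m :
    g Y r (md_tr _ k m) = md_tr (restrict (tm_comp i a) V) k (g X (md_res _ k r) m).
  apply: (etrans (congr1 (fun z => f Y r *: (z : N n Y)) (mm_tr (lam n) k m))).
  apply: (etrans (esym (md_frobenius_l k (f Y r) (lam n X m : N n X)))).
  by congr (md_tr _ _ (_ *: _)); apply: (esym (gm_res f k r)).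
have := @box_linear_map gT _ _ (tm_comp i a) _ _ (bc_mod T n) V _
  (Pairing gDl gDr gZl gZr gR gl gr) (@bc_box _ _ _ _ _ _ _ _ _ _ _ T n).
apply=> h hE X c r m.
have [Z [k [r1 [s1 ->]]]] := coproduct_transfer_of_product coprod c.
rewrite -!md_frobenius_r.
apply: (etrans (mm_tr h k _)).
congr (md_tr _ _ _).
rewrite -(pr_res (bc_pair T n)) -(pr_res (Pairing gDl gDr gZl gZr gR gl gr)) -bc_linear hE.
rewrite /= /g.
apply: (etrans (congr2 (fun z t => z *: (t : N n Z)) (rmorphM (f Z) r1 _) (lamZ Z s1 _))).
rewrite [in RHS]/GRing.scale /= /restr_scale rmorphM ki kj !scalerA.
by rewrite -!mulrA (mulrC (b Z s1)).
Qed.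

Lemma base_change_map : exists h : smmap (const_map kappa) T N,
  forall n X r m, h n X (bc_pair T n X r m) = f X r *: (lam n X m : N n X).
Proof.
pose h n := sval (cid (base_change_map_level n)).
have hE n X r m : h n X (bc_pair T n X r m) = f X r *: (lam n X m : N n X).
  exact: (svalP (cid (base_change_map_level n))).
have nat m n (u : {omorphism 'I_m.+1 -> 'I_n.+1}) X (x : bc_mod T n X) :
    h m X (sm_map (bc_mod T) u X x) = sm_map N u X (h n X x).
  have [g gE] := @semilinear_comp gT C C S (gm_id C) kappa kappa _ _ _
    (sm_map (bc_mod T) u) (h m) (fun _ _ => erefl).
  have [k kE] := @semilinear_comp gT C S S kappa (gm_id S) kappa _ _ _
    (h n) (sm_map N u) (fun _ _ => erefl).
  rewrite -gE -kE; apply: (box_map_eq (@bc_box _ _ _ _ _ _ _ _ _ _ _ T n)) => Y r y.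
  rewrite gE kE -bc_nat !hE (smm_nat lam).
  exact: (esym (linearZZ (sm_map N u Y) (f Y r) (lam n Y y))).
by exists (@SMMap gT O (const C) (const S) (const_map kappa) T N h nat).
Qed.

End BaseChange.

Theorem proposition3p4p8 (gT : finGroupType) (O : indexing_system gT)
    (R' S' R S : tambara O)
    (f' : tmap R' S') (f : tmap R S) (a : tmap R' R) (b : tmap S' S)
    (square : tm_eq (tm_comp f a) (tm_comp b f'))
    (L' : cotangent_complex f') (L : cotangent_complex f)
    (C : tambara O) (i : tmap R C) (j : tmap S' C) (coprod : is_coproduct a f' i j)
    (kappa : tmap C S)
    (kappa_i : tm_eq (tm_comp kappa i) f) (kappa_j : tm_eq (tm_comp kappa j) b)
    (T : base_change a f' i j L') :
  let is_lift (phi : stmap (cc_P L') (cc_P L)) :=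
    stm_eq (stm_comp phi (cc_i L')) (stm_comp (cc_i L) (const_map a)) /\
    stm_eq (stm_comp (cc_p L) phi) (stm_comp (const_map b) (cc_p L')) in
  let K' := cc_kaehler L' in
  let K := cc_kaehler L in
  (exists phi, is_lift phi) /\
  (forall phi, is_lift phi ->
     exists (psi : stmap (ka_square K') (ka_square K))
            (Lambda : smmap (const_map kappa) T L),
       [/\ stm_eq (stm_comp psi (ka_l K')) (stm_comp (ka_l K) phi),
           stm_eq (stm_comp psi (ka_r K')) (stm_comp (ka_r K) phi) &
           forall n X (r : R X) (s : S' X)
             (x : kernel (ka_mu K' n) X) (y : kernel (ka_mu K n) X),
             val y = psi n X (val x) ->
             Lambda n X (bc_pair T n X r (cc_pair L' n X (ka_q x) s))
             = cc_pair L n X (ka_q y) (f X r * b X s)]).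
Proof.
move=> is_lift K' K; split.
  have comm : stm_eq (stm_comp (cc_p L) (stm_comp (cc_i L) (const_map a)))
                     (stm_comp (stm_comp (const_map b) (cc_p L')) (cc_i L')).
    move=> n X x; apply: (etrans (cc_factor L (a X x))).
    apply: (etrans (square X x)).
    exact: (esym (congr1 (b X) (cc_factor L' x))).
  have [phi phi_i phi_p] := cc_cofibration (cc_acyclic_fibration L) comm.
  by exists phi.
move=> phi [phi_i phi_p].
have [psi [psil psir]] := square_map K' K phi_i.
have [w wE] := kaehler_map psil psir.
have [lam lamE] := cotangent_map phi_p w.
have [Lam LamE] := base_change_map coprod kappa_i kappa_j T lam.
exists psi, Lam; split=> // n X r s x y xy.
by rewrite LamE lamE (wE _ _ _ _ xy) -cc_linear.
Qed.
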